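(* Let $$M(1,1)\equiv M(1,1;t,w)=\sum_{n\ge0}t^n\sum_{(P,Q)\in\mathcal{I}_n}\sum_{j=1}^nw^{\tilde Q(j)-3\tilde P(j)}.$$ Let $z=z(t)$ be the formal power series with $t=z(1-z)^3$, $z=t+O(t^2)$. Let $$\begin{aligned}S(V,z,w)={}&V^5w^5z^5+V^5w^4z^5+V^5w^3z^5+5V^4w^5z^4+V^5w^2z^5-2V^4w^5z^3+5V^4w^4z^4-V^3w^4z^5+V^5wz^5\\&-2V^4w^4z^3+5V^4w^3z^4+2V^4w^2z^5+8V^3w^5z^3+3V^3w^4z^4-V^3w^3z^5-2V^4w^3z^3+4V^4w^2z^4+2V^4wz^5\\&-6V^3w^5z^2+5V^3w^4z^3+3V^3w^3z^4+V^3w^2z^5-2V^2w^4z^4-V^4w^2z^3+4V^4wz^4+V^3w^5z-5V^3w^4z^2\\&+5V^3w^3z^3+8V^3w^2z^4+V^3wz^5+4V^2w^5z^2+7V^2w^4z^3-2V^2w^3z^4-V^4wz^3+V^3w^4z-5V^3w^3z^2\\&+V^3w^2z^3+8V^3wz^4-4V^2w^5z-5V^2w^4z^2+7V^2w^3z^3+4V^2w^2z^4+V^3w^3z-V^3w^2z^2+V^3wz^3+V^2w^5\\&+V^2w^4z-5V^2w^3z^2+6V^2w^2z^3+4V^2wz^4-V^3wz^2-2V^3z^3+V^2w^3z-5V^2w^2z^2+5V^2wz^3+4Vw^2z^3\\&+V^3z^2+3V^2w^2z-2V^2wz^2-4V^2z^3-4Vw^2z^2+3Vwz^3-V^2w^2+3Vw^2z-Vwz^2-2Vz^3+V^2z-Vw^2\\&-3Vz^2+2Vz-2z^2+z,\end{aligned}$$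 and let $V_0=V_0(z,w)$ be the formal power series in $z$ (coefficients rational in $w$) with $V_0(0)=0$ and $S(V_0,z,w)=0$ (so $V_0=zw^{-2}+O(z^2)$). Then $M(1,1)$ is algebraic and, expressed in the variables $z,w$, $$M(1,1)=R(z,V_0),\qquad R(z,V)=\frac{(Vz^2-z^2+3z-1)Vw^2}{Vz^4-3Vz^3+3Vz^2+z^3-Vz-3z^2+3z-1}.$$
   Context: A Dyck path of size $n$ is a lattice path from $(0,0)$ to $(2n,0)$ with $n$ up-steps $(1,1)$ and $n$ down-steps $(1,-1)$ never going below height $0$. For $j\in\{1,\dots,n\}$, $\tilde P(j)$ is the height of the initial point of the $j$-th up-step of $P$. The Tamari order is the reflexive transitive closure of the relation: if $P$ has a down-step $d$ immediately followed by an up-step and $\mathfrak{e}$ is the shortest excursion following $d$ (staying strictly above its starting height except at its last point), the path obtained by exchanging $d$ and $\mathfrak{e}$ is larger than $P$. $\mathcal{I}_n$ is the set of pairs $(P,Q)$ of Dyck paths of size $n$ with $P\le Q$ ($P$ lower, $Q$ upper path). $M(1,1)$ is a formal power series in $t$ with coefficients Laurent polynomials in $w$. *)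

(* Defs.v *)
From HB Require Import structures.
From mathcomp Require Import all_boot all_order all_algebra fraction.
Set Implicit Arguments. Unset Strict Implicit. Unset Printing Implicit Defensive.
Import Order.TTheory GRing.Theory Num.Theory.
Local Open Scope ring_scope.

Definition K : fieldType := {fraction {poly rat}}.
Definition w : K := tofrac 'X.

Definition fps := nat -> K.
Definition fps_one : fps := fun n => (n == 0)%:R.
Definition fps_X : fps := fun n => (n == 1)%:R.
Definition fps_mul (f g : fps) : fps :=
  fun n => \sum_(i < n.+1) f i * g (n - i)%N.
Definition fps_pow (f : fps) (k : nat) : fps := iter k (fps_mul f) fps_one.
Definition peval (q : {poly K}) (Z : fps) : fps :=
  fun n => \sum_(j < size q) q`_j * fps_pow Z j n.
Definition eval2 (p : {poly {poly K}}) (Z V : fps) : fps :=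
  fun n => \sum_(i < size p) fps_mul (peval p`_i Z) (fps_pow V i) n.
(** Composition f(g), meaningful when g 0 = 0. *)
Definition fps_comp (f g : fps) : fps :=
  fun n => \sum_(k < n.+1) f k * fps_pow g k n.
Fixpoint inv_seq (f : fps) (n : nat) : seq K :=
  match n with
  | 0 => [:: (f 0%N)^-1]
  | n'.+1 => let s := inv_seq f n' in
      rcons s (- (f 0%N)^-1 * \sum_(i < n'.+1) f i.+1 * nth 0 s (n' - i)%N)
  end.
Definition fps_inv (f : fps) : fps := fun n => nth 0 (inv_seq f n) n.
Definition fps_div (f g : fps) : fps := fps_mul f (fps_inv g).

(** * Dyck paths: sequences of steps, true = up-step, false = down-step. *)
Definition hgt (s : seq bool) : int := (count id s)%:Z - (count negb s)%:Z.
Definition dyckb (n : nat) (s : seq bool) : bool :=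
  [&& size s == n.*2, hgt s == 0 & all (fun m => 0 <= hgt (take m s)) (iota 0 (size s).+1)].
(** [up_heights s]`_(j-1) = \tilde s(j): height of the start of the j-th up-step. *)
Definition up_heights (s : seq bool) : seq int :=
  [seq hgt (take i s) | i <- iota 0 (size s) & nth false s i].
Definition is_exc (e : seq bool) : bool :=
  (0 < size e)%N && (hgt e == 0) && all (fun m => 0 < hgt (take m e)) (iota 1 (size e).-1).
(** Tamari covering step: down-step at position i followed by an up-step;
    e = shortest excursion following it (of length k); Q = P with d and e exchanged. *)
Definition tam_step (P Q : seq bool) : bool :=
  [exists i : 'I_(size P), [exists k : 'I_(size P).+1,
    [&& ~~ nth false P i, nth false P i.+1,
        size (take k (drop i.+1 P)) == k, is_exc (take k (drop i.+1 P)) &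
        Q == take i P ++ take k (drop i.+1 P) ++ false :: drop (i.+1 + k) P]]].
Definition tam_rel (m : nat) : rel (m.-tuple bool) := fun P Q => tam_step P Q.
Definition tamari_le (n : nat) (P Q : (n.*2).-tuple bool) : bool :=
  connect (@tam_rel n.*2) P Q.

Definition Mcoef (n : nat) : K :=
  \sum_(P : (n.*2).-tuple bool | dyckb n P)
   \sum_(Q : (n.*2).-tuple bool | dyckb n Q && tamari_le P Q)
    \sum_(j < n) w ^ (nth 0 (up_heights Q) j - 3 * nth 0 (up_heights P) j).
Definition M11 : fps := Mcoef.

Definition S_expr (R : comPzRingType) (V z w : R) : R :=
  0 + V^+5 * w^+5 * z^+5
  + V^+5 * w^+4 * z^+5
  + V^+5 * w^+3 * z^+5
  + 5%:R * V^+4 * w^+5 * z^+4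
  + V^+5 * w^+2 * z^+5
  - 2%:R * V^+4 * w^+5 * z^+3
  + 5%:R * V^+4 * w^+4 * z^+4
  - V^+3 * w^+4 * z^+5
  + V^+5 * w^+1 * z^+5
  - 2%:R * V^+4 * w^+4 * z^+3
  + 5%:R * V^+4 * w^+3 * z^+4
  + 2%:R * V^+4 * w^+2 * z^+5
  + 8%:R * V^+3 * w^+5 * z^+3
  + 3%:R * V^+3 * w^+4 * z^+4
  - V^+3 * w^+3 * z^+5
  - 2%:R * V^+4 * w^+3 * z^+3
  + 4%:R * V^+4 * w^+2 * z^+4
  + 2%:R * V^+4 * w^+1 * z^+5
  - 6%:R * V^+3 * w^+5 * z^+2
  + 5%:R * V^+3 * w^+4 * z^+3
  + 3%:R * V^+3 * w^+3 * z^+4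
  + V^+3 * w^+2 * z^+5
  - 2%:R * V^+2 * w^+4 * z^+4
  - V^+4 * w^+2 * z^+3
  + 4%:R * V^+4 * w^+1 * z^+4
  + V^+3 * w^+5 * z^+1
  - 5%:R * V^+3 * w^+4 * z^+2
  + 5%:R * V^+3 * w^+3 * z^+3
  + 8%:R * V^+3 * w^+2 * z^+4
  + V^+3 * w^+1 * z^+5
  + 4%:R * V^+2 * w^+5 * z^+2
  + 7%:R * V^+2 * w^+4 * z^+3
  - 2%:R * V^+2 * w^+3 * z^+4
  - V^+4 * w^+1 * z^+3
  + V^+3 * w^+4 * z^+1
  - 5%:R * V^+3 * w^+3 * z^+2
  + V^+3 * w^+2 * z^+3
  + 8%:R * V^+3 * w^+1 * z^+4
  - 4%:R * V^+2 * w^+5 * z^+1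
  - 5%:R * V^+2 * w^+4 * z^+2
  + 7%:R * V^+2 * w^+3 * z^+3
  + 4%:R * V^+2 * w^+2 * z^+4
  + V^+3 * w^+3 * z^+1
  - V^+3 * w^+2 * z^+2
  + V^+3 * w^+1 * z^+3
  + V^+2 * w^+5
  + V^+2 * w^+4 * z^+1
  - 5%:R * V^+2 * w^+3 * z^+2
  + 6%:R * V^+2 * w^+2 * z^+3
  + 4%:R * V^+2 * w^+1 * z^+4
  - V^+3 * w^+1 * z^+2
  - 2%:R * V^+3 * z^+3
  + V^+2 * w^+3 * z^+1
  - 5%:R * V^+2 * w^+2 * z^+2
  + 5%:R * V^+2 * w^+1 * z^+3
  + 4%:R * V^+1 * w^+2 * z^+3
  + V^+3 * z^+2
  + 3%:R * V^+2 * w^+2 * z^+1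
  - 2%:R * V^+2 * w^+1 * z^+2
  - 4%:R * V^+2 * z^+3
  - 4%:R * V^+1 * w^+2 * z^+2
  + 3%:R * V^+1 * w^+1 * z^+3
  - V^+2 * w^+2
  + 3%:R * V^+1 * w^+2 * z^+1
  - V^+1 * w^+1 * z^+2
  - 2%:R * V^+1 * z^+3
  + V^+2 * z^+1
  - V^+1 * w^+2
  - 3%:R * V^+1 * z^+2
  + 2%:R * V^+1 * z^+1
  - 2%:R * z^+2
  + z^+1.
Definition Rnum_expr (R : comPzRingType) (V z w : R) : R :=
  (V * z^+2 - z^+2 + 3%:R * z - 1) * V * w^+2.
Definition Rden_expr (R : comPzRingType) (V z w : R) : R :=
  V * z^+4 - 3%:R * V * z^+3 + 3%:R * V * z^+2 + z^+3 - V * z - 3%:R * z^+2 + 3%:R * z - 1.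
Definition Spoly : {poly {poly K}} := S_expr 'X ('X)%:P (w%:P)%:P.
Definition Rnum : {poly {poly K}} := Rnum_expr 'X ('X)%:P (w%:P)%:P.
Definition Rden : {poly {poly K}} := Rden_expr 'X ('X)%:P (w%:P)%:P.

Definition fps_algebraic (f : fps) : Prop :=
  exists p : {poly {poly K}}, p != 0 /\ eval2 p fps_X f =1 (fun _ => 0).

(* Main.v *)
From HB Require Import structures.
Require Import Defs.
From mathcomp Require Import all_boot all_order all_algebra fraction.
From mathcomp Require Import zify ring boolp.
From Stdlib Require Import Relation_Operators.
Set Implicit Arguments. Unset Strict Implicit. Unset Printing Implicit Defensive.
Import Order.TTheory GRing.Theory Num.Theory.
Local Open Scope ring_scope.

(** An interval [P <= Q] of size n + 1 splits uniquely as [P = U l D r P2],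
    [Q = U Q1 D Q2] with [l r <= Q1], [P2 <= Q2] and [l] returning to height 0, so
    choosing [l] amounts to choosing a contact of [l r]. Marking an up-step and counting
    by x and y the contacts of the lower path before and after it, the height weights
    depend only on whether the chosen contact precedes the mark, whence a linear equation
    with two catalytic variables. Cancelling its two nested kernels, i.e. solving
      (x - 1) y = t w x F(x) F(y),   y - 1 = t w^-2 F(x) F(y)
    with F the series of unmarked intervals, gives M(1,1) = w^2 (F(y) - F(1)). F is
    rational in z and u under x = (1 + u) / (1 + z u)^2; if v is the parameter of y,
    eliminating u from the kernel equations leaves S(v, z, w) = 0. *)

(** * Tamari intervals *)

(** The exponent [3] acts through [1 - 3 = -2]: gluing raises a mark of the first interval by one in
    [Q], and by one in [P] too when the chosen contact comes after it. The two weights [c = w] and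
    [d = w^-2] are then tied by [c^2 d = 1], which the elimination relies on. Summing over contacts
    produces divided differences, but the proof does not divide by [x - 1] or [y - 1]: identities
    are stated with these factors multiplied out, and the factors are cancelled once the series are
    known to be nonzero. For this reason [x] and [y] must be shown different from 1. F is not
    derived but checked: its rational form satisfies a functional equation that has a single
    solution. Nor is S ever solved: [u] and [v] are built as a fixed point of the kernel equations,
    contracting because of a factor [z]. The series [v] is recognized as [V_0(z)] because the
    derivative of S in V at [z = V = 0] is [-w^2], so that S has only one root without constant
    term. *)

Lemma hgt_cat (s1 s2 : seq bool) : hgt (s1 ++ s2) = hgt s1 + hgt s2.
Proof. rewrite /hgt !count_cat; lia. Qed.

Lemma hgt_cons (b : bool) (s : seq bool) :
  hgt (b :: s) = (if b then 1 else -1) + hgt s.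
Proof. by rewrite /hgt /=; case: b => /=; lia. Qed.

Lemma hgt_nil : hgt [::] = 0.
Proof. by []. Qed.

Definition hgtE := (hgt_cat, hgt_cons, hgt_nil).

Definition nonneg (s : seq bool) : bool :=
  all (fun m => 0 <= hgt (take m s)) (iota 0 (size s).+1).

Lemma nonnegP (s : seq bool) :
  reflect (forall a b, s = a ++ b -> 0 <= hgt a) (nonneg s).
Proof.
apply: (iffP allP) => [H a b Es | H m _].
  have := H (size a); rewrite mem_iota Es size_cat take_size_cat //; apply; lia.
by apply: (H _ (drop m s)); rewrite cat_take_drop.
Qed.

Definition dyck (s : seq bool) : bool := (hgt s == 0) && nonneg s.

Lemma dyckbE (n : nat) (s : seq bool) : dyckb n s = (size s == n.*2) && dyck s.
Proof. by []. Qed.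

Lemma nonneg_cat (a b : seq bool) :
  hgt a = 0 -> nonneg (a ++ b) = nonneg a && nonneg b.
Proof.
move=> ha; apply/nonnegP/andP => [H | [/nonnegP Ha /nonnegP Hb] c d].
  split; apply/nonnegP => c d E.
    by apply: (H c (d ++ b)); rewrite E catA.
  by have := H (a ++ c) d; rewrite E catA hgtE ha add0r; apply.
move=> E; case: (leqP (size c) (size a)) => sca.
  apply: (Ha c (drop (size c) a)); rewrite -[LHS](cat_take_drop (size c)).
  congr (_ ++ _); have := congr1 (take (size c)) E.
  by rewrite take_cat take_size_cat //; case: ltngtP sca => // -> _; rewrite subnn take0 cats0 take_size.
have Ec : c = a ++ drop (size a) c.
  rewrite -[LHS](cat_take_drop (size a)); congr (_ ++ _).
  by have := congr1 (take (size a)) E; rewrite take_size_cat // take_cat sca.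
rewrite Ec hgtE ha add0r; apply: (Hb _ d).
have := congr1 (drop (size a)) E; rewrite drop_size_cat // => ->.
by rewrite drop_cat sca.
Qed.

Lemma dyck_cat (a b : seq bool) : dyck a -> dyck (a ++ b) = dyck b.
Proof.
by move=> /andP[/eqP ha na]; rewrite /dyck nonneg_cat // na hgtE ha add0r.
Qed.

Lemma dyck_catr (a b : seq bool) : hgt a = 0 -> dyck (a ++ b) -> dyck a /\ dyck b.
Proof.
by move=> ha; rewrite /dyck nonneg_cat // hgtE ha add0r => /and3P[-> -> ->].
Qed.

Lemma cat_split (T : Type) (A B C D : seq T) : A ++ B = C ++ D ->
  (exists E, A = C ++ E /\ D = E ++ B) \/ (exists E, C = A ++ E /\ B = E ++ D).
Proof.
elim: A C => [|x A IH] [|y C] /=.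
- by move=> ->; left; exists [::].
- by move=> ->; right; exists (y :: C).
- by move=> <-; left; exists (x :: A).
case=> -> /IH [[E [-> ->]]|[E [-> ->]]]; [left|right]; by exists E.
Qed.

Lemma dyck_lift (s : seq bool) : dyck s -> dyck (true :: s ++ [:: false]).
Proof.
move=> /andP[/eqP hs /nonnegP ns]; rewrite /dyck !hgtE hs /=.
apply/nonnegP => -[|c a] b //= [<- E]; rewrite hgtE.
case: (cat_split E) => -[E' [E1 E2]].
  by have := ns _ _ E1; lia.
rewrite E1 hgtE hs; case: E' E2 {E1} => [|b1 [|? ?]] //=.
by case=> <-; rewrite !hgtE.
Qed.

Lemma dyck_lift_cat (s1 s2 : seq bool) :
  dyck s1 -> dyck s2 -> dyck (true :: s1 ++ false :: s2).
Proof.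
move=> d1 d2; have := dyck_lift d1.
rewrite (_ : true :: s1 ++ false :: s2 = (true :: s1 ++ [:: false]) ++ s2); last by rewrite /= -catA.
by move/dyck_cat->.
Qed.

Lemma dyck_exc (s : seq bool) : dyck s -> is_exc (true :: s ++ [:: false]).
Proof.
move=> ds; move: (ds) => /andP[/eqP hs ns]; rewrite /is_exc !hgtE hs /=.
apply/allP => -[|m]; rewrite mem_iota //= size_cat addn1 => mb.
rewrite take_cat; case: ltnP => mb2; rewrite /= !hgtE /=.
  move/nonnegP: ns => /(_ (take m s) (drop m s)); rewrite cat_take_drop => /(_ erefl); lia.
by rewrite (_ : m - size s = 0)%N ?take0 ?hs //; lia.
Qed.

Lemma is_excP (e : seq bool) : is_exc e ->
  [/\ e <> [::], hgt e = 0 & forall a b, e = a ++ b -> a <> [::] -> b <> [::] -> 0 < hgt a].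
Proof.
case/andP=> /andP[e0 /eqP he] /allP H; split=> // [|a b E a0 b0].
  by case: e e0 {he H}.
have := H (size a); rewrite mem_iota E take_size_cat // size_cat; apply.
by case: a b a0 b0 {E} => [|x a] // [|y b] //=; lia.
Qed.

Lemma exc_head (e : seq bool) : is_exc e -> exists e', e = true :: e'.
Proof.
case/is_excP; case: e => [|b e] // _ he H.
case: b he H => he H; first by exists e.
case: e he H => [|x e] // _ H.
by have : 0 < hgt [:: false] by apply: (H _ (x :: e)).
Qed.

Lemma not_nonneg_split (s : seq bool) :
  ~~ nonneg s -> exists a b, s = a ++ false :: b /\ dyck a.
Proof.
elim/last_ind: s => // s b IH.
case: (boolP (nonneg s)) => [ns|/IH [a [c [-> da]]] _]; last first.
  by exists a, (rcons c b); rewrite rcons_cat.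
move=> nn; suff: (b == false) && (hgt s == 0).
  move=> /andP[/eqP -> hs]; exists s, [::]; rewrite cats1; split=> //.
  exact/andP.
apply/negP => H; case/negP: nn; apply/nonnegP => c d.
case/lastP: d => [|d x]; rewrite ?cats0.
  move=> <-; rewrite -cats1 !hgtE.
  have := nonnegP _ ns s [::]; rewrite cats0 => /(_ erefl).
  case: b H => /=; lia.
by rewrite -rcons_cat => /rcons_inj [E _]; apply: (nonnegP _ ns _ _ E).
Qed.

Lemma dyck_first_return (s : seq bool) : dyck s -> s <> [::] ->
  exists a b, [/\ s = true :: a ++ false :: b, dyck a & dyck b].
Proof.
case: s => [|x s] // /andP[/eqP hs ns] _.
have hx : x = true.
  by have := nonnegP _ ns [:: x] s erefl; rewrite !hgtE; case: (x).
rewrite {x}hx in hs ns *.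
(* Without its first up-step the path ends at height -1; the down-step where it first goes below 0
   is the first return. *)
have : ~~ nonneg s.
  apply/negP => /nonnegP /(_ s [::]); rewrite cats0 => /(_ erefl).
  by move: hs; rewrite !hgtE; lia.
case/not_nonneg_split => a [b [E da]]; exists a, b; split; rewrite -?E //.
have : dyck (true :: s) by rewrite /dyck ns hs.
rewrite E (_ : true :: a ++ false :: b = (true :: a ++ [:: false]) ++ b); last by rewrite /= -catA.
by rewrite dyck_cat // dyck_lift.
Qed.

Lemma first_return_inj (a b a' b' : seq bool) : dyck a -> dyck a' ->
  a ++ false :: b = a' ++ false :: b' -> a = a' /\ b = b'.
Proof.
(* If [c] properly extended [c'], its next step would be the down-step that follows [c'], taking a
   prefix of [c] to height -1. *)
have key c c' d d' : dyck c -> dyck c' -> c ++ false :: d = c' ++ false :: d' ->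
  forall E, c = c' ++ E -> E = [::].
  move=> /andP[hc nc] /andP[/eqP hc' nc'] H [|x E] // Ec.
  move: H; rewrite Ec -catA => /eqP; rewrite eqseq_cat // eqxx /= => /eqP [hx _].
  have := nonnegP _ nc (c' ++ [:: x]) E; rewrite Ec -catA => /(_ erefl).
  by rewrite !hgtE hc' hx.
move=> da da' H; have [[E [E1 _]]|[E [E1 _]]] := cat_split H.
  have E0 := key _ _ _ _ da da' H _ E1; move: E1 H; rewrite E0 cats0 => ->.
  by move/eqP; rewrite eqseq_cat // eqxx /= => /eqP [->].
have E0 := key _ _ _ _ da' da (esym H) _ E1; move: E1 H; rewrite E0 cats0 => ->.
by move/eqP; rewrite eqseq_cat // eqxx /= => /eqP [->].
Qed.

Lemma dyck_size_even (s : seq bool) : hgt s = 0 -> size s = (count id s).*2.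
Proof. by rewrite -(count_predC id s) /hgt (@eq_count _ (predC id) negb) //; lia. Qed.

(** * Tamari moves on words *)

Lemma tam_stepP (P Q : seq bool) : tam_step P Q <->
  exists a e b, [/\ is_exc e, P = a ++ false :: e ++ b & Q = a ++ e ++ false :: b].
Proof.
split.
  case/existsP => i /existsP[k /and5P[Pi _ _ exc /eqP ->]].
  exists (take i P), (take k (drop i.+1 P)), (drop (i.+1 + k) P); split => //.
  rewrite [(i.+1 + k)%N]addnC -drop_drop cat_take_drop -[LHS](cat_take_drop i); congr (_ ++ _).
  rewrite (drop_nth false) //; by case: nth Pi.
case=> a [e [b [exc EP EQ]]].
have si : (size a < size P)%N by rewrite EP size_cat /=; lia.
have sk : (size e < (size P).+1)%N by rewrite EP size_cat /= size_cat; lia.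
apply/existsP; exists (Ordinal si); apply/existsP; exists (Ordinal sk) => /=.
have dP : drop (size a).+1 P = e ++ b.
  by rewrite EP -add1n -drop_drop drop_size_cat //= drop0.
rewrite [(_.+1 + _)%N]addnC -drop_drop dP take_size_cat // drop_size_cat // exc eqxx.
rewrite EQ EP take_size_cat // !nth_cat ltnn subnn /=.
rewrite ltnNge leqnSn /= subSnn /=.
by have [e' ->] := exc_head exc; rewrite /= !eqxx.
Qed.

(** The closure is taken on words of any length, so that moves can be performed inside an arbitrary
    context. *)
Definition star := clos_refl_trans (seq bool) tam_step.

Lemma star_ctx (x y s1 s2 : seq bool) : star s1 s2 -> star (x ++ s1 ++ y) (x ++ s2 ++ y).
Proof.
elim=> [P Q /tam_stepP [a [e [b [exc -> ->]]]] | P | P Q R _ IH1 _ IH2].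
- apply: rt_step; apply/tam_stepP; exists (x ++ a), e, (b ++ y).
  by split=> //; rewrite -!catA /= -?catA.
- exact: rt_refl.
- exact: rt_trans IH1 IH2.
Qed.

(** A Dyck path is a product of excursions, and one cover carries the down-step past one of them. *)
Lemma star_move (s : seq bool) : dyck s -> star (false :: s) (s ++ [:: false]).
Proof.
elim: {s}(size s) {-2}s (leqnn (size s)) => [|n IH] s.
  by rewrite leqn0 size_eq0 => /eqP -> _; apply: rt_refl.
move=> sn ds; case: (eqVneq s [::]) => [->|/eqP s0]; first exact: rt_refl.
have [a [b [E da db]]] := dyck_first_return ds s0.
pose e := true :: a ++ [:: false].
have Es : s = e ++ b by rewrite /e E /= -catA.
apply: (@rt_trans _ _ _ (e ++ false :: b)).
  apply: rt_step; apply/tam_stepP; exists [::], e, b; split; rewrite ?Es //.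
  exact: dyck_exc.
rewrite Es -catA; have := @star_ctx e [::] (false :: b) (b ++ [:: false]).
rewrite !cats0; apply; apply: IH => //.
by move: sn; rewrite E /= size_cat /=; lia.
Qed.

(** * Recursive enumeration of the intervals *)

Definition contacts (s : seq bool) : seq nat :=
  [seq m <- iota 0 (size s).+1 | hgt (take m s) == 0].

Definition glue (m : nat) (P1 P2 : seq bool) : seq bool :=
  true :: take m P1 ++ false :: drop m P1 ++ P2.

Definition join_int (d : (seq bool * seq bool) * nat) (r : seq bool * seq bool) :=
  (glue d.2 d.1.1 r.1, true :: d.1.2 ++ false :: r.2).

Definition pointed (L : seq (seq bool * seq bool)) :=
  [seq (pq, m) | pq <- L, m <- contacts pq.1].

Definition ints_next (f : nat -> seq (seq bool * seq bool)) (n : nat) :=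
  flatten [seq [seq join_int d r | d <- pointed (f i), r <- f (n - i)%N] | i <- iota 0 n.+1].

(** Course-of-values recursion: size [n + 1] draws on all smaller sizes, so the whole table is
    carried along. *)
Fixpoint ints_tab (n : nat) : seq (seq (seq bool * seq bool)) :=
  if n is n'.+1 then rcons (ints_tab n') (ints_next (nth [::] (ints_tab n')) n')
  else [:: [:: ([::], [::])]].

Definition ints (n : nat) := nth [::] (ints_tab n) n.

Lemma size_ints_tab (n : nat) : size (ints_tab n) = n.+1.
Proof. by elim: n => //= n IH; rewrite size_rcons IH. Qed.

Lemma nth_ints_tab (n i : nat) : (i <= n)%N -> nth [::] (ints_tab n) i = ints i.
Proof.
elim: n => [|n IH]; first by case: i.
rewrite leq_eqVlt => /predU1P [-> //|lin].
by rewrite /= nth_rcons size_ints_tab lin IH.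
Qed.

Lemma intsS (n : nat) : ints n.+1 =
  flatten [seq [seq join_int d r | d <- pointed (ints i), r <- ints (n - i)%N] | i <- iota 0 n.+1].
Proof.
have -> : ints n.+1 =
  nth [::] (rcons (ints_tab n) (ints_next (nth [::] (ints_tab n)) n)) n.+1 by [].
rewrite nth_rcons size_ints_tab ltnn eqxx /ints_next; congr (flatten _).
apply/eq_in_map => i; rewrite mem_iota => /andP[_ ib].
by rewrite !nth_ints_tab //; lia.
Qed.

Lemma contactsP (s : seq bool) (m : nat) :
  reflect ((m <= size s)%N /\ hgt (take m s) = 0) (m \in contacts s).
Proof.
rewrite mem_filter mem_iota add0n ltnS.
by apply: (iffP and3P) => [[/eqP -> _ ->]|[-> ->]].
Qed.

Lemma mem_intsS (n : nat) (P Q : seq bool) : (P, Q) \in ints n.+1 <->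
  exists i l r P2 Q1 Q2, [/\ (i <= n)%N, (l ++ r, Q1) \in ints i, hgt l = 0,
    (P2, Q2) \in ints (n - i)%N &
    P = true :: l ++ false :: r ++ P2 /\ Q = true :: Q1 ++ false :: Q2].
Proof.
rewrite intsS; split.
  case/flattenP => L /mapP[i]; rewrite mem_iota => ib ->.
  case/allpairsP => -[d [P2 Q2]] /= [/allpairsPdep [[P1 Q1] [m [d1 /contactsP [sm hm] ->]]] d2].
  case=> -> ->; exists i, (take m P1), (drop m P1), P2, Q1, Q2.
  by rewrite cat_take_drop; split => //=; lia.
case=> i [l [r [P2 [Q1 [Q2 [lin d1 hl d2 [-> ->]]]]]]].
apply/flattenP; eexists; first by apply/mapP; exists i; [rewrite mem_iota; lia|].
apply/allpairsP; exists (((l ++ r, Q1), size l), (P2, Q2)); split => //=.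
  apply/allpairsPdep; exists (l ++ r, Q1), (size l); split=> //.
  by apply/contactsP; rewrite /= size_cat leq_addr take_size_cat.
by rewrite /join_int /glue /= take_size_cat // drop_size_cat.
Qed.

Lemma ints_dyck (n : nat) (P Q : seq bool) : (P, Q) \in ints n ->
  [/\ dyck P, dyck Q, size P = n.*2 & size Q = n.*2].
Proof.
move: P Q; elim/ltn_ind: n => [[|n] IH] P Q.
  by rewrite inE => /eqP[-> ->].
case/mem_intsS => i [l [r [P2 [Q1 [Q2 [lin d1 hl d2 [-> ->]]]]]]].
have [d1d d1' s1 s1'] := IH i (ltac:(lia)) _ _ d1.
have [d2d d2' s2 s2'] := IH (n - i)%N (ltac:(lia)) _ _ d2.
have [dl dr] := dyck_catr hl d1d.
split.
- by apply: dyck_lift_cat => //; rewrite dyck_cat.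
- exact: dyck_lift_cat.
- by move: s1; rewrite /= !size_cat /= !size_cat; lia.
- by rewrite /= !size_cat /=; lia.
Qed.

(** A climb in three stages: [U l D r P2] to [U l r D P2] by pushing the down-step through the Dyck
    path [r], then to [U Q1 D P2], then to [U Q1 D Q2]. *)
Lemma ints_star (n : nat) (P Q : seq bool) : (P, Q) \in ints n -> star P Q.
Proof.
move: P Q; elim/ltn_ind: n => [[|n] IH] P Q.
  by rewrite inE => /eqP[-> ->]; apply: rt_refl.
case/mem_intsS => i [l [r [P2 [Q1 [Q2 [lin d1 hl d2 [-> ->]]]]]]].
have [d1d _ _ _] := ints_dyck d1; have [dl dr] := dyck_catr hl d1d.
apply: (@rt_trans _ _ _ (true :: (l ++ r) ++ false :: P2)).
  have := @star_ctx (true :: l) P2 _ _ (star_move dr).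
  by rewrite /= -?catA.
apply: (@rt_trans _ _ _ (true :: Q1 ++ false :: P2)).
  by apply: (@star_ctx [:: true] (false :: P2)); apply: IH d1; lia.
have := @star_ctx (true :: Q1 ++ [:: false]) [::] P2 Q2.
by rewrite !cats0 /= -?catA; apply; apply: IH d2; lia.
Qed.

Lemma ints_refl (n : nat) (Q : seq bool) : dyck Q -> size Q = n.*2 -> (Q, Q) \in ints n.
Proof.
move: Q; elim/ltn_ind: n => [[|n] IH] Q dQ sQ; first by case: Q sQ {dQ}.
have [|a [b [E da db]]] := dyck_first_return dQ; first by move=> E; rewrite E in sQ.
have [/eqP ha _] := andP da; have [/eqP hb _] := andP db.
have sa := dyck_size_even ha; have sb := dyck_size_even hb.
move: sQ; rewrite E /= size_cat /= => sQ.
(* The diagonal pair chooses the last contact of [a], so [r] is empty. *)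
apply/mem_intsS; exists (count id a), a, [::], b, a, b; rewrite cats0; split => //.
- lia.
- apply: IH => //; lia.
- apply: IH => //; lia.
Qed.

(** The excursion [e] starts at height at least 0 and stays strictly above its start until its end,
    so a point at height 0 cannot fall strictly inside the block [e D]: the block lies on one side
    of the cut. *)
Lemma exc_split (A B a e b : seq bool) : hgt A = 0 -> nonneg (A ++ B) -> is_exc e ->
  A ++ B = a ++ e ++ false :: b ->
  (exists b1, A = a ++ e ++ false :: b1 /\ b = b1 ++ B) \/
  (exists a2, a = A ++ a2 /\ B = a2 ++ e ++ false :: b).
Proof.
move=> hA nAB exc E; have [e0 he pe] := is_excP exc.
case: (cat_split E) => [[E1 [EA Ee]]|[E1 [-> ->]]]; last by right; exists E1.
have ha : 0 <= hgt a by apply: (nonnegP _ nAB a _ E).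
(* A cut just after [e] would be followed by a down-step to height -1. *)
have contra : E1 = e -> False.
  move=> Ee1; have := nonnegP _ nAB (A ++ [:: false]) b.
  move: Ee; rewrite Ee1 => /eqP; rewrite eqseq_cat // eqxx /= => /eqP <-.
  by rewrite -catA /= => /(_ erefl); rewrite !hgtE hA.
case: (cat_split Ee) => -[E2 [F1 F2]].
  case: (eqVneq E1 [::]) => [E10|/eqP E10].
    by right; exists [::]; rewrite EA E10 !cats0; move: Ee; rewrite E10 => ->.
  case: (eqVneq E2 [::]) => [E20|/eqP E20].
    by case: contra; rewrite F1 E20 cats0.
  have := pe _ _ F1 E10 E20; move: hA; rewrite EA hgtE; lia.
case: E2 F1 F2 => [|x E2] /=.
  by rewrite cats0 => /contra.
by move=> F1 E3; case: E3 F1 => <- -> F1; left; exists E2; rewrite EA F1.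
Qed.

(** This is why the recursion misses no interval. The block [e D] of [P'] lies in [U l D], in [r] or
    in [P2]. If its down-step is the one after [l], only the contact changes; otherwise the move is
    undone inside a smaller interval. *)
Lemma ints_down (n : nat) (P P' Q : seq bool) :
  tam_step P P' -> (P', Q) \in ints n -> (P, Q) \in ints n.
Proof.
move: P P' Q; elim/ltn_ind: n => [[|n] IH] P P' Q /tam_stepP [a [e [b [exc -> EP]]]].
  rewrite inE => /eqP[E _]; move: EP; rewrite E.
  by case: (a) => [|? ?] //; case: (e).
case/mem_intsS => i [l [r [P2 [Q1 [Q2 [lin d1 hl d2 [E ->]]]]]]].
have [e0 he pe] := is_excP exc.
have [D1 _ _ _] := ints_dyck d1; have [dl dr] := dyck_catr hl D1.
have [D2 _ _ _] := ints_dyck d2.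
have step x y : tam_step (x ++ false :: e ++ y) (x ++ e ++ false :: y).
  by apply/tam_stepP; exists x, e, y.
have dP : dyck P' by rewrite E; apply: dyck_lift_cat => //; rewrite dyck_cat.
have a0 : a <> [::].
  move=> a0; have := nonnegP _ (proj2 (andP dP)) (e ++ [:: false]) b.
  by rewrite EP a0 /= -catA => /(_ erefl); rewrite !hgtE he.
have E2 : (true :: l ++ [:: false]) ++ (r ++ P2) = a ++ e ++ false :: b.
  by rewrite -EP E /= -catA.
have [||[b1 [F1 ->]]|[a2 [-> F2]]] := exc_split _ _ exc E2.
- by rewrite !hgtE hl.
- by rewrite E2 -EP; case/andP: dP.
- case: a a0 F1 {EP E2} => // x a2 _ /= [<-].
  (* If [b1] is empty, the block ends with the [D] after [l], and [l = a2 e]. Undoing the move hands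
     [e] from [l] to [r]: the contact moves back while the word [l r] stays the same. *)
  case/lastP: b1 => [|b1 y].
    rewrite cats1 catA cats1 => /rcons_inj [F1].
    apply/mem_intsS; exists i, a2, (e ++ r), P2, Q1, Q2; split => //.
    + by rewrite catA -F1.
    + by move: hl; rewrite F1 hgtE he addr0.
    + by rewrite /= -?catA.
  rewrite cats1 -rcons_cons -!rcons_cat => /rcons_inj [F1 Fy].
  apply/mem_intsS; exists i, (a2 ++ false :: e ++ b1), r, P2, Q1, Q2; split => //.
  + apply: IH d1; first by lia.
    by rewrite F1 -!catA /= -?catA; exact: (step a2 (b1 ++ r)).
  + by move: hl; rewrite F1 !hgtE; lia.
  + by rewrite -Fy /= -?catA /= -?catA /= cat_rcons.
have [||[b2 [F3 ->]]|[a3 [-> F4]]] := exc_split _ _ exc F2.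
- by case/andP: dr => /eqP.
- by rewrite nonneg_cat; case/andP: dr => [/eqP // _ ->]; case/andP: D2.
- apply/mem_intsS; exists i, l, (a2 ++ false :: e ++ b2), P2, Q1, Q2; split => //.
    apply: IH d1; first by lia.
    by have := step (l ++ a2) b2; rewrite F3 -!catA.
  by rewrite /= -?catA /= -?catA.
apply/mem_intsS; exists i, l, r, (a3 ++ false :: e ++ b), Q1, Q2; split => //.
  apply: IH d2; first by lia.
  by rewrite F4; apply: step.
by rewrite /= -?catA /= -?catA.
Qed.

Lemma tam_step_size (P Q : seq bool) : tam_step P Q -> size Q = size P.
Proof.
by case/tam_stepP => a [e [b [_ -> ->]]]; rewrite !size_cat /= !size_cat /=; lia.
Qed.

(** One direction is [ints_star]. For the other, a chain from [P] to [Q] is walked backwards from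
    the diagonal pair [(Q, Q)] with [ints_down]. *)
Lemma mem_ints (n : nat) (P Q : (n.*2).-tuple bool) :
  ((val P, val Q) \in ints n) = dyckb n P && (dyckb n Q && tamari_le P Q).
Proof.
apply/idP/and3P => [H|[_ /andP[_ dQ] /connectP [p + E]]].
  have [dP dQ sP sQ] := ints_dyck H.
  rewrite !dyckbE dP dQ !size_tuple eqxx; split=> //.
  have := ints_star H; rewrite /tamari_le.
  have key A B : star A B -> size A = n.*2 -> size B = n.*2 /\
     forall A' B' : (n.*2).-tuple bool, val A' = A -> val B' = B -> connect (@tam_rel n.*2) A' B'.
    elim=> [A1 B1 st s1 | A1 s1 | A1 B1 C1 _ IH1 _ IH2 s1].
    - split; first by rewrite (tam_step_size st).
      by move=> A' B' EA EB; apply: connect1; rewrite /tam_rel EA EB.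
    - by split=> // A' B' EA EB; rewrite (val_inj (etrans EA (esym EB))).
    - have [s2 H1] := IH1 s1; have [s3 H2] := IH2 s2; split=> // A' B' EA EB.
      have s2' : size B1 == n.*2 by apply/eqP.
      apply: (@connect_trans _ _ (Tuple s2')); [exact: H1|exact: H2].
  by case/key; rewrite ?size_tuple // => _ /(_ P Q erefl erefl).
elim: p P E => [|R p IH] P /= E.
  by rewrite E => _; apply: ints_refl; rewrite -?E // size_tuple.
by case/andP => st pth; apply: (ints_down st); apply: IH.
Qed.

(** The decomposition is unambiguous: the first return of [Q] yields [Q1], [Q2] and the size [i],
    the first return of [P] yields [l], and lengths then separate [r] from [P2]. *)
Lemma uniq_ints (n : nat) : uniq (ints n).
Proof.
elim/ltn_ind: n => [[|n] IH] //.
rewrite intsS.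
pose t i := [seq (d, r) | d <- pointed (ints i), r <- ints (n - i)%N].
rewrite (_ : flatten _ = [seq join_int x.1 x.2 | i <- iota 0 n.+1, x <- t i]); last first.
  by congr (flatten _); apply: eq_map => i; rewrite /t map_allpairs.
apply: allpairs_uniq_dep; first exact: iota_uniq.
  move=> i; rewrite mem_iota => ib; apply: allpairs_uniq.
  - apply: allpairs_uniq_dep; first by apply: IH; lia.
      by move=> pq _; apply/filter_uniq/iota_uniq.
    by move=> [? ?] [? ?] _ _ /= [-> ->].
  - by apply: IH; lia.
  - by move=> [? ?] [? ?] _ _.
move=> y1 y2 /allpairsPdep [i1 [x1 [ib1 tx1 ->]]] /allpairsPdep [i2 [x2 [ib2 tx2 ->]]] /=.
case/allpairsPdep: tx1 => -[pq1 k1] [[R1 S1] [+ d1 ->]].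
case/allpairsPdep => -[P1 Q1] [m1 [c1 /contactsP [sm1 hm1] [-> ->]]].
case/allpairsPdep: tx2 => -[pq2 k2] [[R2 S2] [+ d2 ->]].
case/allpairsPdep => -[P2 Q2] [m2 [c2 /contactsP [sm2 hm2] [-> ->]]].
rewrite /join_int /glue /= in sm1 hm1 sm2 hm2 *; case=> EP EQ.
have [DP1 DQ1 sP1 sQ1] := ints_dyck c1.
have [DP2 DQ2 sP2 sQ2] := ints_dyck c2.
have [F1 F2] := first_return_inj DQ1 DQ2 EQ; rewrite {EQ S1}F2 in d1 *.
have Ei : i1 = i2 by apply: double_inj; rewrite -sQ1 -sQ2 F1.
rewrite {i1}Ei {Q1}F1 in c1 sP1 ib1 d1 sQ1 DQ1 *.
have [dl1 dr1] : dyck (take m1 P1) /\ dyck (drop m1 P1).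
  by apply: dyck_catr; rewrite ?cat_take_drop.
have [dl2 dr2] : dyck (take m2 P2) /\ dyck (drop m2 P2).
  by apply: dyck_catr; rewrite ?cat_take_drop.
have [G1 G2] := first_return_inj dl1 dl2 EP.
have Em : m1 = m2 by move/(congr1 size): G1; rewrite !size_takel.
rewrite Em in G1 G2 sm1 *.
move/eqP: G2; rewrite eqseq_cat ?size_drop ?sP1 ?sP2 // => /andP[/eqP G3 /eqP ->].
by rewrite -(cat_take_drop m2 P1) G1 G3 cat_take_drop.
Qed.

(** * Catalytic statistics *)

(** Leaving out the starting point makes the statistic additive under concatenation at height 0. *)
Definition returns (s : seq bool) : nat :=
  count (fun m => hgt (take m s) == 0) (iota 1 (size s)).

Lemma returns_rcons (s : seq bool) (b : bool) :
  returns (rcons s b) = (returns s + (hgt (rcons s b) == 0))%N.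
Proof.
rewrite /returns size_rcons -(addn1 (size s)) iotaD count_cat /= addn0.
rewrite add1n take_oversize ?size_rcons //; congr (_ + _)%N.
apply: eq_in_count => m; rewrite mem_iota => mb.
by rewrite -cats1 takel_cat //; lia.
Qed.

Lemma returns_cat (s1 s2 : seq bool) : hgt s1 = 0 ->
  returns (s1 ++ s2) = (returns s1 + returns s2)%N.
Proof.
move=> h1; elim/last_ind: s2 => [|s2 b IH]; first by rewrite cats0 addn0.
by rewrite -rcons_cat !returns_rcons IH rcons_cat hgt_cat h1 add0r addnA.
Qed.

Lemma nonneg_rcons (s : seq bool) (b : bool) : nonneg (rcons s b) -> nonneg s.
Proof.
move=> /nonnegP H; apply/nonnegP => c d E.
by apply: (H _ (rcons d b)); rewrite E rcons_cat.
Qed.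

Lemma nonneg_hgt (s : seq bool) : nonneg s -> 0 <= hgt s.
Proof. by move/nonnegP => /(_ s [::]); rewrite cats0 => /(_ erefl). Qed.

Lemma returns_lift (s : seq bool) : nonneg s -> returns (true :: s) = 0%N.
Proof.
elim/last_ind: s => // s b IH ns.
rewrite -rcons_cons returns_rcons IH ?(nonneg_rcons ns) // rcons_cons hgt_cons.
have := nonneg_hgt ns; case: eqP => //; lia.
Qed.

Definition ups (s : seq bool) : seq (int * nat) :=
  [seq (hgt (take i s), returns (take i s)) | i <- iota 0 (size s) & nth false s i].

Lemma up_heightsE (s : seq bool) : up_heights s = map fst (ups s).
Proof. by rewrite /ups -map_comp. Qed.

Lemma ups_rcons (s : seq bool) (b : bool) :
  ups (rcons s b) = ups s ++ (if b then [:: (hgt s, returns s)] else [::]).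
Proof.
rewrite /ups size_rcons -(addn1 (size s)) iotaD filter_cat map_cat /= add0n nth_rcons ltnn eqxx.
congr (_ ++ _); last by case: b => //=; rewrite -cats1 take_size_cat.
rewrite (@eq_in_filter _ _ (nth false s)); last first.
  by move=> i; rewrite mem_iota add0n nth_rcons => /andP[_ ->].
apply/eq_in_map => i; rewrite mem_filter mem_iota add0n => /and3P[_ _ ib].
by rewrite -cats1 takel_cat //; lia.
Qed.

Lemma size_ups (s : seq bool) : size (ups s) = count id s.
Proof.
elim/last_ind: s => // s b IH; rewrite ups_rcons size_cat IH -cats1 count_cat.
by case: b.
Qed.

Lemma ups_cat (s1 s2 : seq bool) : hgt s1 = 0 ->
  ups (s1 ++ s2) = ups s1 ++ [seq (p.1, (returns s1 + p.2)%N) | p <- ups s2].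
Proof.
move=> h1; elim/last_ind: s2 => [|s2 b IH]; first by rewrite !cats0.
rewrite -rcons_cat !ups_rcons IH map_cat -catA; congr (_ ++ (_ ++ _)).
by case: b => //=; rewrite hgt_cat h1 add0r returns_cat.
Qed.

Lemma ups_lift (s : seq bool) : nonneg s ->
  ups (true :: s) = (0, 0%N) :: [seq (p.1 + 1, 0%N) | p <- ups s].
Proof.
elim/last_ind: s => // s b IH ns; have ns' := nonneg_rcons ns.
rewrite -rcons_cons !ups_rcons IH // map_cat cat_cons; congr (_ :: (_ ++ _)).
by case: b {ns} => //=; rewrite returns_lift // hgt_cons addrC.
Qed.

Lemma ups_returns_le (s : seq bool) (p : int * nat) : p \in ups s -> (p.2 <= returns s)%N.
Proof.
elim/last_ind: s => // s b IH; rewrite ups_rcons mem_cat returns_rcons => /orP[/IH|].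
  by lia.
by case: b => //; rewrite inE => /eqP -> /=; lia.
Qed.

(** The inequality is strict because the final return comes after every up-step. *)
Lemma ups_returns_lt (s : seq bool) (p : int * nat) : hgt s = 0 -> p \in ups s -> (p.2 < returns s)%N.
Proof.
case/lastP: s => // s b h; rewrite ups_rcons mem_cat returns_rcons h eqxx addn1 ltnS.
case/orP; first exact: ups_returns_le.
by case: b {h} => //; rewrite inE => /eqP -> /=.
Qed.

Lemma returns_lift_cat (s1 s2 : seq bool) : dyck s1 ->
  returns (true :: s1 ++ false :: s2) = (returns s2).+1.
Proof.
move=> /andP[/eqP h1 n1].
rewrite (_ : true :: s1 ++ false :: s2 = (rcons (true :: s1) false) ++ s2); last first.
  by rewrite -cats1 /= -catA.
have h : hgt (rcons (true :: s1) false) = 0 by rewrite -cats1 !hgtE h1.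
by rewrite returns_cat // returns_rcons returns_lift // h.
Qed.

Lemma ups_lift_cat (s1 s2 : seq bool) : dyck s1 ->
  ups (true :: s1 ++ false :: s2) =
    (0, 0%N) :: [seq (p.1 + 1, 0%N) | p <- ups s1] ++ [seq (p.1, p.2.+1) | p <- ups s2].
Proof.
move=> /andP[/eqP h1 n1].
rewrite (_ : true :: s1 ++ false :: s2 = (rcons (true :: s1) false) ++ s2); last first.
  by rewrite -cats1 /= -catA.
have h : hgt (rcons (true :: s1) false) = 0 by rewrite -cats1 !hgtE h1.
by rewrite ups_cat // ups_rcons ups_lift // returns_rcons returns_lift // h cats0.
Qed.

(** Indexing contacts by the returns up to them turns a sum over the chosen contact into a geometric
    sum. *)
Lemma returns_contacts (s : seq bool) :
  [seq returns (take m s) | m <- contacts s] = iota 0 (returns s).+1.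
Proof.
elim/last_ind: s => // s b IH.
rewrite /contacts size_rcons -(addn1 (size s).+1) iotaD filter_cat map_cat.
rewrite (_ : [seq _ <- iota 0 (size s).+1 | _] = contacts s); last first.
  apply: eq_in_filter => m; rewrite mem_iota => mb.
  by rewrite -cats1 takel_cat //; lia.
rewrite (_ : [seq returns (take m (rcons s b)) | m <- contacts s] = iota 0 (returns s).+1); last first.
  rewrite -IH; apply/eq_in_map => m /contactsP[mb _].
  by rewrite -cats1 takel_cat.
rewrite returns_rcons -addSn iotaD /= add0n take_oversize ?size_rcons //.
by case: eqP => h //=; rewrite take_oversize ?size_rcons // returns_rcons h eqxx addn1.
Qed.

(* For each up-step: its height in Q, its height in P, and the number of returns of P
   to 0 before it. *)
Definition marks (P Q : seq bool) : seq (int * (int * nat)) := zip (up_heights Q) (ups P).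

Lemma zip_map2 (S T S' T' : Type) (f : S -> S') (g : T -> T') (s : seq S) (t : seq T) :
  zip (map f s) (map g t) = [seq (f p.1, g p.2) | p <- zip s t].
Proof. by elim: s t => [|x s IH] [|y t] //=; rewrite IH. Qed.

(** In [Q] all of [Q1] is lifted. In [P] the inserted down-step ends the lift after [l]: a mark in
    [l] rises and has no return before it, while a mark in [r] keeps its height and trades the
    returns of [l] for the single return closing [U l D]. Marks of the second interval only gain
    returns before them. *)
Lemma marks_join (n1 n2 m : nat) (P1 Q1 P2 Q2 : seq bool) :
  (P1, Q1) \in ints n1 -> (P2, Q2) \in ints n2 -> m \in contacts P1 ->
  marks (glue m P1 P2) (true :: Q1 ++ false :: Q2) = (0, (0, 0%N)) ::
    [seq (e.1 + 1, if (e.2.2 < returns (take m P1))%N then (e.2.1 + 1, 0%N)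
          else (e.2.1, (1 + (e.2.2 - returns (take m P1)))%N)) | e <- marks P1 Q1]
    ++ [seq (e.1, (e.2.1, (1 + returns (drop m P1) + e.2.2)%N)) | e <- marks P2 Q2].
Proof.
move=> i1 i2 /contactsP[mb hm].
have [D1 dQ1 s1 s1'] := ints_dyck i1; have [D2 dQ2 s2 s2'] := ints_dyck i2.
move: i1 D1 s1; rewrite /glue; move: (take m P1) (drop m P1) (cat_take_drop m P1) hm => l r <- {P1 mb} hl i1 D1 s1.
have [dl dr] := dyck_catr hl D1.
have [/eqP hr _] := andP dr.
have [/eqP hlr _] := andP D1; have [/eqP hQ1 _] := andP dQ1.
rewrite /marks !up_heightsE !ups_lift_cat //= (ups_cat P2 hr) (ups_cat r hl).
congr (_ :: _); rewrite !map_cat catA.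
set g := fun p : int * nat => if (p.2 < returns l)%N then (p.1 + 1, 0%N)
  else (p.1, (1 + (p.2 - returns l))%N).
have -> : [seq (p.1 + 1, 0%N) | p <- ups l] ++ [seq (p.1, p.2.+1) | p <- ups r] =
    map g (ups l ++ [seq (p.1, (returns l + p.2)%N) | p <- ups r]).
  rewrite map_cat -map_comp; congr (_ ++ _).
    by apply/eq_in_map => p pl; rewrite /g ups_returns_lt.
  by apply/eq_map => p; rewrite /g /= ltnNge leq_addr addKn add1n.
rewrite -(map_comp fst _ (ups Q1)) -(map_comp fst _ (ups Q2)) -(map_comp _ _ (ups P2)) zip_cat; last first.
  rewrite (size_map _ (ups Q1)) (size_map g) size_cat (size_map _ (ups r)) !size_ups -count_cat.
  have := dyck_size_even hlr; have := dyck_size_even hQ1; rewrite s1 s1' => e1 e2.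
  by apply: double_inj; rewrite -e1 -e2.
congr (_ ++ _).
  by rewrite (map_comp (fun q => q + 1) fst) zip_map2.
have -> : map (fst \o (fun p : int * nat => (p.1, p.2.+1))) (ups Q2) =
  map id (map fst (ups Q2)) by rewrite map_id.
rewrite zip_map2 map_id; apply: eq_map => -[q [p a]] /=; by rewrite addSn.
Qed.

Lemma sum_ints (R : nmodType) (n : nat) (F : seq bool * seq bool -> R) :
  \sum_(I <- ints n.+1) F I =
  \sum_(i < n.+1) \sum_(d <- ints i) \sum_(e <- ints (n - i)%N)
    \sum_(m <- contacts d.1) F (join_int (d, m) e).
Proof.
rewrite intsS big_flatten big_map (_ : iota 0 n.+1 = index_iota 0 n.+1) ?big_mkord; last first.
  by rewrite /index_iota subn0.
apply: eq_bigr => i _; rewrite big_allpairs_dep /=.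
rewrite /pointed big_allpairs_dep /=.
by apply: eq_bigr => d _; rewrite exchange_big.
Qed.

Lemma sum_contacts (R : nmodType) (s : seq bool) (F : nat -> R) :
  \sum_(m <- contacts s) F (returns (take m s)) = \sum_(i < (returns s).+1) F i.
Proof.
rewrite -(big_map (fun m => returns (take m s)) xpredT F) returns_contacts.
rewrite (_ : iota 0 _ = index_iota 0 (returns s).+1) ?big_mkord //.
Qed.

(** * Functional equations with catalytic variables *)

Section Functional.

Variables (R : comNzRingType) (om : int -> R).
Hypotheses (om0 : om 0 = 1) (omD : forall i j, om (i + j) = om i * om j).

(* The paper counts the starting point as a contact, so that its F(x) is x times the
   series of the [fcoef]; likewise for [hcoef] in the variable x. *)
Definition fcoef (n : nat) (x : R) : R := \sum_(I <- ints n) x ^+ returns I.1.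

(** Here [k] is the total number of returns of the lower path, so that [x] counts those before the
    mark and [y] those after it. *)
Definition mono (x y : R) (k : nat) (e : int * (int * nat)) : R :=
  om (e.1 - 3 * e.2.1) * x ^+ e.2.2 * y ^+ (k - e.2.2).

Definition hcoef (n : nat) (x y : R) : R :=
  \sum_(I <- ints n) \sum_(e <- marks I.1 I.2) mono x y (returns I.1) e.

Lemma geom_rev (x : R) (k : nat) :
  (x - 1) * (\sum_(i < k) x ^+ (1 + (k.-1 - i))) = x * (x ^+ k - 1).
Proof.
rewrite subrX1 [RHS]mulrCA; congr (_ * _); rewrite mulr_sumr.
rewrite [RHS](reindex_inj rev_ord_inj) /=; apply: eq_bigr => i _.
by rewrite -exprS; congr (_ ^+ _); have := ltn_ord i; lia.
Qed.

Lemma returns_take_drop (m : nat) (P : seq bool) : m \in contacts P ->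
  returns P = (returns (take m P) + returns (drop m P))%N.
Proof.
by move=> /contactsP[_ hm]; rewrite -returns_cat // cat_take_drop.
Qed.

Lemma returns_glue (n m : nat) (P1 Q1 P2 : seq bool) :
  (P1, Q1) \in ints n -> m \in contacts P1 ->
  returns (glue m P1 P2) = (1 + (returns P1 - returns (take m P1)) + returns P2)%N.
Proof.
move=> i1 cm; have := returns_take_drop cm.
have [D1 _ _ _] := ints_dyck i1; case/contactsP: cm => mb hm.
have [dl dr] : dyck (take m P1) /\ dyck (drop m P1).
  by apply: dyck_catr; rewrite ?cat_take_drop.
rewrite returns_lift_cat // returns_cat; last by case/andP: dr => /eqP.
lia.
Qed.

Lemma fcoef0 (x : R) : fcoef 0 x = 1.
Proof. by rewrite /fcoef /ints /= big_seq1. Qed.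

Lemma hcoef0 (x y : R) : hcoef 0 x y = 0.
Proof. by rewrite /hcoef /ints /= big_seq1 /marks /= big_nil. Qed.

Lemma sum_prod (n1 n2 : nat) (A B : seq bool * seq bool -> R) :
  \sum_(d <- ints n1) \sum_(e <- ints n2) A d * B e =
  (\sum_(d <- ints n1) A d) * (\sum_(e <- ints n2) B e).
Proof. by rewrite big_distrlr. Qed.

Lemma geom_contacts (x : R) (P : seq bool) :
  (x - 1) * (\sum_(m <- contacts P) x ^+ (1 + (returns P - returns (take m P)))) =
  x * (x * x ^+ returns P - 1).
Proof.
rewrite (sum_contacts P (fun i => x ^+ (1 + (returns P - i)))).
by rewrite (geom_rev x (returns P).+1) exprS.
Qed.

(** Summed over the chosen contact, the powers of [x] form a divided difference; the factor [x - 1]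
    replaces the division. *)
Lemma fcoefS (n : nat) (x : R) :
  (x - 1) * fcoef n.+1 x =
  \sum_(i < n.+1) x * (x * fcoef i x - fcoef i 1) * fcoef (n - i) x.
Proof.
rewrite /fcoef sum_ints mulr_sumr; apply: eq_bigr => i _.
transitivity (\sum_(d <- ints i) \sum_(e <- ints (n - i)%N)
    (x * (x * x ^+ returns d.1 - 1 ^+ returns d.1)) * x ^+ returns e.1).
  rewrite mulr_sumr; apply: eq_big_seq => -[P Q] dI.
  rewrite mulr_sumr; apply: eq_big_seq => e eI /=.
  rewrite expr1n -(geom_contacts x P) -mulrA mulr_suml; congr (_ * _).
  apply: eq_big_seq => m mP; rewrite /join_int /= (returns_glue _ dI mP).
  by rewrite exprD.
by rewrite sum_prod -mulr_sumr sumrB -mulr_sumr.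
Qed.

Lemma mem_zip2 (S T : eqType) (s : seq S) (t : seq T) (e : S * T) :
  e \in zip s t -> e.2 \in t.
Proof.
elim: s t => [|a s IH] [|b t] //=; rewrite !inE => /orP[/eqP ->|/IH ->].
  by rewrite eqxx.
by rewrite orbT.
Qed.

Lemma marks_returns (n : nat) (P Q : seq bool) (e : int * (int * nat)) :
  (P, Q) \in ints n -> e \in marks P Q -> (e.2.2 < returns P)%N.
Proof.
move=> dI /mem_zip2 H; apply: ups_returns_lt H.
by have [/andP[/eqP]] := ints_dyck dI.
Qed.

(** The mark has [a] of the [k1] returns before it, and [i] is the chosen contact. If [i <= a] the
    mark falls in [r]: only its height in [Q] rises, and the sum is geometric in [x] with weight
    [om 1]. If [i > a] it falls in [l]: both heights rise, and the sum is geometric in [y] with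
    weight [om (1 - 3)]. *)
Lemma mark_geom (x y : R) (q p : int) (a k1 k2 : nat) : (a < k1)%N ->
  (x - 1) * (y - 1) * (\sum_(i < k1.+1) mono x y (1 + (k1 - i) + k2)
     (q + 1, if (a < i)%N then (p + 1, 0%N) else (p, (1 + (a - i))%N))) =
  (y - 1) * (om 1 * x * (x * mono x y k1 (q, (p, a)) - mono 1 y k1 (q, (p, a)))) * y ^+ k2 +
  (x - 1) * (om (-2) * y * (mono 1 y k1 (q, (p, a)) - mono 1 1 k1 (q, (p, a)))) * y ^+ k2.
Proof.
move=> ak; rewrite /mono /=.
pose c := om (q - 3 * p).
rewrite -(big_mkord xpredT (fun i => om (q + 1 - 3 * (if (a < i)%N then (p + 1, 0%N) else (p, (1 + (a - i))%N)).1)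
  * x ^+ (if (a < i)%N then (p + 1, 0%N) else (p, (1 + (a - i))%N)).2
  * y ^+ (1 + (k1 - i) + k2 - (if (a < i)%N then (p + 1, 0%N) else (p, (1 + (a - i))%N)).2))).
rewrite (@big_cat_nat _ _ _ a.+1) //=; last by lia.
rewrite (_ : \sum_(0 <= i < a.+1) _ =
    c * om 1 * y ^+ (k1 - a) * y ^+ k2 * \sum_(i < a.+1) x ^+ (1 + (a - i))); last first.
  rewrite big_mkord mulr_sumr; apply: eq_bigr => i _.
  have ia : (i <= a)%N by have := ltn_ord i; lia.
  rewrite ltnNge ia /= (_ : q + 1 - 3 * p = (q - 3 * p) + 1); last by ring.
  rewrite omD -/c (_ : 1 + (k1 - i) + k2 - (1 + (a - i)) = (k1 - a) + k2)%N; last by lia.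
  by rewrite (exprD y); ring.
rewrite (_ : \sum_(a.+1 <= i < k1.+1) _ =
    c * om (-2) * y ^+ k2 * \sum_(i < k1 - a) y ^+ (1 + ((k1 - a).-1 - i))); last first.
  rewrite -{1}[a.+1]add0n big_addn subSS big_mkord mulr_sumr; apply: eq_bigr => i _.
  have ia : (i < k1 - a)%N by apply: ltn_ord.
  rewrite (_ : (a < i + a.+1)%N = true) /=; last by lia.
  rewrite (_ : q + 1 - 3 * (p + 1) = (q - 3 * p) + (-2)); last by ring.
  rewrite omD -/c (_ : 1 + (k1 - (i + a.+1)) + k2 - 0 = (1 + ((k1 - a).-1 - i)) + k2)%N; last by lia.
  by rewrite (exprD y (1 + _)); ring.
have G1 := geom_rev x a.+1; have G2 := geom_rev y (k1 - a); rewrite /= in G1.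
rewrite mulrDr.
transitivity ((y - 1) * (c * om 1 * y ^+ (k1 - a) * y ^+ k2 * (x * (x ^+ a.+1 - 1)))
   + (x - 1) * (c * om (-2) * y ^+ k2 * (y * (y ^+ (k1 - a) - 1)))).
  by rewrite -G1 -G2; ring.
by rewrite -/c !expr1n exprS; ring.
Qed.

(** The four terms come from the new first up-step, from the marks of the second interval, and from
    the marks of the first interval with the contact before, respectively after, the mark. *)
Lemma hcoef_join (x y : R) (n1 n2 : nat) (P1 Q1 P2 Q2 : seq bool) :
  (P1, Q1) \in ints n1 -> (P2, Q2) \in ints n2 ->
  let H x y := \sum_(e <- marks P1 Q1) mono x y (returns P1) e in
  (x - 1) * (y - 1) * (\sum_(m <- contacts P1)
     \sum_(e <- marks (glue m P1 P2) (true :: Q1 ++ false :: Q2))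
        mono x y (returns (glue m P1 P2)) e) =
  (x - 1) * (y - 1) * (\sum_(m <- contacts P1) y ^+ returns (glue m P1 P2))
  + (y - 1) * ((x * (x * x ^+ returns P1 - 1)) * \sum_(e <- marks P2 Q2) mono x y (returns P2) e)
  + (y - 1) * (om 1 * x * (x * H x y - H 1 y)) * y ^+ returns P2
  + (x - 1) * (om (-2) * y * (H 1 y - H 1 1)) * y ^+ returns P2.
Proof.
move=> i1 i2 H.
pose k1 := returns P1; pose k2 := returns P2.
transitivity ((x - 1) * (y - 1) * (\sum_(m <- contacts P1) (y ^+ returns (glue m P1 P2)
  + (\sum_(e <- marks P1 Q1) mono x y (1 + (k1 - returns (take m P1)) + k2)
     (e.1 + 1, if (e.2.2 < returns (take m P1))%N then (e.2.1 + 1, 0%N)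
         else (e.2.1, (1 + (e.2.2 - returns (take m P1)))%N))
  + x ^+ (1 + (returns P1 - returns (take m P1))) * \sum_(e <- marks P2 Q2) mono x y k2 e)))).
  congr (_ * _); apply: eq_big_seq => m cm.
  rewrite (marks_join i1 i2 cm) big_cons big_cat /= !big_map (returns_glue _ i1 cm).
  rewrite {1}/mono /= om0 expr0 subn0 !mul1r; congr (_ + (_ + _)).
  rewrite mulr_sumr; apply: eq_big_seq => -[q [p a]] eI.
  rewrite /mono /= (_ : returns (drop m P1) = returns P1 - returns (take m P1))%N; last first.
    by rewrite (returns_take_drop cm); lia.
  rewrite (exprD x) subnDl; ring.
rewrite big_split /= big_split /=; set A := \sum_(m <- contacts P1) y ^+ _.
set B := \sum_(m <- _) \sum_(e <- _) _; set Z := \sum_(m <- _) _ * _.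
have E1 : (x - 1) * Z = x * (x * x ^+ returns P1 - 1) * \sum_(e <- marks P2 Q2) mono x y k2 e.
  by rewrite /Z -mulr_suml mulrA (geom_contacts x P1).
have E2 : (x - 1) * (y - 1) * B =
    (y - 1) * (om 1 * x * (x * H x y - H 1 y)) * y ^+ k2
    + (x - 1) * (om (-2) * y * (H 1 y - H 1 1)) * y ^+ k2.
  rewrite /B exchange_big /= /H.
  rewrite !mulr_sumr -!sumrB !mulr_sumr !mulr_suml -big_split /=.
  apply: eq_big_seq => -[q [p a]] eI /=.
  rewrite (sum_contacts P1 (fun i => mono x y (1 + (k1 - i) + k2) (q + 1,
    if (a < i)%N then (p + 1, 0%N) else (p, (1 + (a - i))%N)))).
  by rewrite mark_geom ?(marks_returns i1 eI) //.
transitivity ((x - 1) * (y - 1) * A + (x - 1) * (y - 1) * B + (y - 1) * ((x - 1) * Z)).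
  by ring.
by rewrite E1 E2 /k2; ring.
Qed.

Lemma hcoefS (n : nat) (x y : R) :
  (x - 1) * (y - 1) * hcoef n.+1 x y =
  (x - 1) * (y - 1) * fcoef n.+1 y
  + (y - 1) * (\sum_(i < n.+1) x * (x * fcoef i x - fcoef i 1) * hcoef (n - i) x y)
  + (y - 1) * (\sum_(i < n.+1) om 1 * x * (x * hcoef i x y - hcoef i 1 y) * fcoef (n - i) y)
  + (x - 1) * (\sum_(i < n.+1) om (-2) * y * (hcoef i 1 y - hcoef i 1 1) * fcoef (n - i) y).
Proof.
rewrite {1}/hcoef {1}/fcoef !sum_ints !mulr_sumr -!big_split /=.
apply: eq_bigr => i _.
pose H (d : seq bool * seq bool) x y := \sum_(e <- marks d.1 d.2) mono x y (returns d.1) e.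
transitivity (\sum_(d <- ints i) \sum_(e <- ints (n - i)%N)
  ((x - 1) * (y - 1) * (\sum_(m <- contacts d.1) y ^+ returns (glue m d.1 e.1))
  + (y - 1) * (x * (x * x ^+ returns d.1 - 1 ^+ returns d.1)) * H e x y
  + (y - 1) * (om 1 * x * (x * H d x y - H d 1 y)) * y ^+ returns e.1
  + (x - 1) * (om (-2) * y * (H d 1 y - H d 1 1)) * y ^+ returns e.1)).
  rewrite mulr_sumr; apply: eq_big_seq => -[P1 Q1] i1.
  rewrite mulr_sumr; apply: eq_big_seq => -[P2 Q2] i2.
  by rewrite (hcoef_join x y i1 i2) /= expr1n /H /= mulrA.
transitivity (\sum_(d <- ints i) \sum_(e <- ints (n - i)%N)
  ((x - 1) * (y - 1) * (\sum_(m <- contacts d.1) y ^+ returns (glue m d.1 e.1)))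
  + ((\sum_(d <- ints i) \sum_(e <- ints (n - i)%N)
  (y - 1) * (x * (x * x ^+ returns d.1 - 1 ^+ returns d.1)) * H e x y)
  + ((\sum_(d <- ints i) \sum_(e <- ints (n - i)%N)
   (y - 1) * (om 1 * x * (x * H d x y - H d 1 y)) * y ^+ returns e.1)
  + (\sum_(d <- ints i) \sum_(e <- ints (n - i)%N)
   (x - 1) * (om (-2) * y * (H d 1 y - H d 1 1)) * y ^+ returns e.1)))).
  rewrite -!big_split /=; apply: eq_bigr => d _; rewrite -!big_split /=.
  by apply: eq_bigr => e _; rewrite !addrA.
rewrite -[RHS]addrA -[RHS]addrA; congr (_ + (_ + (_ + _))).
- by rewrite mulr_sumr; apply: eq_bigr => d _; rewrite mulr_sumr.
- rewrite (sum_prod i (n - i) (fun d => (y - 1) * (x * (x * x ^+ returns d.1 - 1 ^+ returns d.1)))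
    (fun e => H e x y)) -mulr_sumr -mulr_sumr sumrB -mulr_sumr.
  by rewrite !mulrA.
- rewrite (sum_prod i (n - i) (fun d => (y - 1) * (om 1 * x * (x * H d x y - H d 1 y)))
    (fun e => y ^+ returns e.1)) -mulr_sumr -mulr_sumr sumrB -mulr_sumr.
  by rewrite !mulrA.
- rewrite (sum_prod i (n - i) (fun d => (x - 1) * (om (-2) * y * (H d 1 y - H d 1 1)))
    (fun e => y ^+ returns e.1)) -mulr_sumr -mulr_sumr sumrB.
  by rewrite !mulrA.
Qed.

End Functional.

(** * Formal power series *)

Definition ps (R : Type) := nat -> R.

HB.instance Definition _ (R : Type) := gen_eqMixin (ps R).
HB.instance Definition _ (R : Type) := gen_choiceMixin (ps R).

Lemma psP (R : Type) (f g : ps R) : f =1 g -> f = g.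
Proof. exact: funext. Qed.

Section Ring.
Variable R : comNzRingType.
Implicit Types f g h : ps R.

Definition ps_zero : ps R := fun=> 0.
Definition ps_opp f : ps R := fun n => - f n.
Definition ps_add f g : ps R := fun n => f n + g n.
Definition ps_one : ps R := fun n => (n == 0%N)%:R.
Definition ps_mul f g : ps R := fun n => \sum_(i < n.+1) f i * g (n - i)%N.

Fact ps_addA : associative ps_add.
Proof. by move=> f g h; apply: psP => n; rewrite /ps_add addrA. Qed.
Fact ps_addC : commutative ps_add.
Proof. by move=> f g; apply: psP => n; rewrite /ps_add addrC. Qed.
Fact ps_add0 : left_id ps_zero ps_add.
Proof. by move=> f; apply: psP => n; rewrite /ps_add add0r. Qed.
Fact ps_addN : left_inverse ps_zero ps_opp ps_add.
Proof. by move=> f; apply: psP => n; rewrite /ps_add addNr. Qed.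

HB.instance Definition _ := GRing.isZmodule.Build (ps R) ps_addA ps_addC ps_add0 ps_addN.

(** Associativity and commutativity of the series product are inherited from polynomials through
    truncation. *)
Definition tr (N : nat) f : {poly R} := \poly_(i < N) f i.

Lemma coef_tr (N n : nat) f : (n < N)%N -> (tr N f)`_n = f n.
Proof. by move=> nN; rewrite coef_poly nN. Qed.

Lemma coef_trM (N n : nat) f g : (n < N)%N -> (tr N f * tr N g)`_n = ps_mul f g n.
Proof.
move=> nN; rewrite coefM; apply: eq_bigr => i _; have := ltn_ord i => il.
by rewrite !coef_tr //; lia.
Qed.

Fact ps_mulA : associative ps_mul.
Proof.
move=> f g h; apply: psP => n; pose N := n.+1.
transitivity ((tr N f * (tr N g * tr N h))`_n).
  rewrite coefM; apply: eq_bigr => i _; have := ltn_ord i => il.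
  by rewrite coef_tr // coef_trM //; lia.
rewrite mulrA coefM; apply: eq_bigr => i _; have := ltn_ord i => il.
by rewrite coef_trM // coef_tr //; lia.
Qed.

Fact ps_mulC : commutative ps_mul.
Proof.
by move=> f g; apply: psP => n; rewrite -!(@coef_trM n.+1) // mulrC.
Qed.

Fact ps_mul1 : left_id ps_one ps_mul.
Proof.
move=> f; apply: psP => n; rewrite /ps_mul big_ord_recl subn0 mul1r big1 ?addr0 //.
by move=> i _; rewrite mul0r.
Qed.

Fact ps_mulDl : left_distributive ps_mul ps_add.
Proof.
move=> f g h; apply: psP => n; rewrite /ps_mul /ps_add -big_split /=.
by apply: eq_bigr => i _; rewrite mulrDl.
Qed.

Fact ps_one_neq0 : ps_one != 0.
Proof.
by apply/eqP => /(congr1 (fun f : ps R => f 0%N)) /eqP; rewrite /ps_one /= oner_eq0.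
Qed.

HB.instance Definition _ := GRing.Zmodule_isComNzRing.Build (ps R)
  ps_mulA ps_mulC ps_mul1 ps_mulDl ps_one_neq0.

Lemma ps0E n : (0 : ps R) n = 0. Proof. by []. Qed.
Lemma ps1E n : (1 : ps R) n = (n == 0%N)%:R. Proof. by []. Qed.
Lemma psDE f g n : (f + g) n = f n + g n. Proof. by []. Qed.
Lemma psNE f n : (- f) n = - f n. Proof. by []. Qed.
Lemma psBE f g n : (f - g) n = f n - g n. Proof. by []. Qed.
Lemma psME f g n : (f * g) n = \sum_(i < n.+1) f i * g (n - i)%N. Proof. by []. Qed.

Lemma psM0 f g : (f * g) 0%N = f 0%N * g 0%N.
Proof. by rewrite psME big_ord1. Qed.

Lemma psX0 f k : (f ^+ k) 0%N = f 0%N ^+ k.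
Proof. by elim: k => [|k IH]; rewrite ?exprS ?psM0 ?IH. Qed.

Lemma ps_sumE (I : Type) (r : seq I) (P : pred I) (F : I -> ps R) n :
  (\sum_(i <- r | P i) F i) n = \sum_(i <- r | P i) F i n.
Proof. by elim/big_rec2: _ => // i x y _ <-. Qed.

Definition psC (c : R) : ps R := fun n => if n == 0%N then c else 0.

Lemma psC_mulE c f n : (psC c * f) n = c * f n.
Proof.
rewrite psME big_ord_recl subn0 big1 ?addr0 // => i _.
by rewrite mul0r.
Qed.

Fact psC_zmod : zmod_morphism psC.
Proof. by move=> a b; apply: psP => -[|n]; rewrite psBE /psC //= subr0. Qed.
Fact psC_monoid : monoid_morphism psC.
Proof.
split; first by apply: psP => -[|n].
by move=> a b; apply: psP => n; rewrite psC_mulE /psC; case: n => //= n; rewrite mulr0.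
Qed.
HB.instance Definition _ := GRing.isZmodMorphism.Build R (ps R) psC psC_zmod.
HB.instance Definition _ := GRing.isMonoidMorphism.Build R (ps R) psC psC_monoid.

Definition psT : ps R := fun n => (n == 1%N)%:R.

Lemma psT_mul0 f : (psT * f) 0%N = 0.
Proof. by rewrite psM0 mul0r. Qed.

Lemma psT_mulS f n : (psT * f) n.+1 = f n.
Proof.
rewrite psME big_ord_recl mul0r add0r big_ord_recl /= subSS subn0 mul1r.
by rewrite big1 ?addr0 // => i _; rewrite mul0r.
Qed.

(** Congruence modulo the [n]-th power of the variable. *)
Definition eqm (n : nat) f g := forall i, (i < n)%N -> f i = g i.

Lemma eqm_refl n f : eqm n f f. Proof. by []. Qed.

Lemma eqmD n f f' g g' : eqm n f f' -> eqm n g g' -> eqm n (f + g) (f' + g').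
Proof. by move=> H1 H2 i ib; rewrite !psDE H1 ?H2. Qed.

Lemma eqmN n f f' : eqm n f f' -> eqm n (- f) (- f').
Proof. by move=> H1 i ib; rewrite !psNE H1. Qed.

Lemma eqmM n f f' g g' : eqm n f f' -> eqm n g g' -> eqm n (f * g) (f' * g').
Proof.
move=> H1 H2 i ib; rewrite !psME; apply: eq_bigr => j _; have := ltn_ord j => jl.
by rewrite H1 ?H2 //; lia.
Qed.

Lemma eqmX n f f' k : eqm n f f' -> eqm n (f ^+ k) (f' ^+ k).
Proof. by move=> H; elim: k => [|k IH] //; rewrite !exprS; apply: eqmM. Qed.

Lemma eqm_mulS n (z : ps R) f f' : z 0%N = 0 -> eqm n f f' -> eqm n.+1 (z * f) (z * f').
Proof.
move=> z0 H i ib; rewrite !psME; apply: eq_bigr => -[[|j] jl] _ /=.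
  by rewrite z0 !mul0r.
by rewrite H //; lia.
Qed.

(** Each application settles one more coefficient, so coefficient [n] can be read off iterate
    [n + 1]. The index type [I] allows systems of equations. *)
Lemma contraction_fix (I : Type) (Phi : (I -> ps R) -> I -> ps R) :
  (forall n u v, (forall i, eqm n (u i) (v i)) -> forall i, eqm n.+1 (Phi u i) (Phi v i)) ->
  exists u, forall i, u i = Phi u i.
Proof.
move=> H; pose s n := iter n Phi (fun _ => 0).
have sS n m : (n <= m)%N -> forall i, eqm n (s n i) (s m i).
  elim: n m => [|n IH] [|m] // nm i.
  by rewrite /s /=; apply: H => j; apply: IH.
exists (fun i n => s n.+1 i n) => i; apply: psP => n.
apply: (H n (s n)) => // j k kn.
exact: esym (sS k.+1 n kn j k (ltnSn k)).
Qed.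

Lemma ps_inv_exists f : f 0%N = 1 -> exists g, f * g = 1 /\ g 0%N = 1.
Proof.
move=> f0; have [|u Hu] := @contraction_fix unit (fun u _ => 1 - (f - 1) * u tt).
  move=> n u v uv _; apply: eqmD => //; apply: eqmN; apply: eqm_mulS => //.
  by rewrite psBE f0 subrr.
have E := Hu tt; exists (u tt); split; first by rewrite -[f](subrK 1) mulrDl mul1r {2}E; ring.
by rewrite E psBE psM0 psBE f0 subrr mul0r subr0.
Qed.

End Ring.

Arguments psT {R}.

Lemma ps_mul_eq0 (R : idomainType) (f g : ps R) : f * g = 0 -> f = 0 \/ g = 0.
Proof.
move=> fg; case: (pselect (f = 0)) => [->|f0]; first by left.
have [a [fa fb]] : exists a, f a != 0 /\ forall i, (i < a)%N -> f i = 0.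
  have /existsNP [b /eqP fb] : ~ forall b, f b = 0 by move=> H; apply: f0; apply: psP.
  have ex : exists b, f b != 0 by exists b.
  case: (ex_minnP ex) => a fa amin; exists a; split=> // i ia.
  by apply/eqP/negPn/negP => /amin; lia.
right; apply: psP => n; elim/ltn_ind: n => n IH.
have := congr1 (fun h : ps R => h (a + n)%N) fg; rewrite /= psME ps0E.
have an : (a < (a + n).+1)%N by lia.
rewrite (bigD1 (Ordinal an)) //= addKn big1 ?addr0.
  by move/eqP; rewrite mulf_eq0 (negPf fa) => /eqP.
move=> i ia; have := ltn_ord i => il; have {}ia : nat_of_ord i != a by [].
case: (ltnP i a) => ia2; first by rewrite fb // mul0r.
by rewrite IH ?mulr0 //; lia.
Qed.

Lemma ps_mulI (R : idomainType) (f g h : ps R) : f <> 0 -> f * g = f * h -> g = h.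
Proof.
move=> f0 /eqP; rewrite -subr_eq0 -mulrBr => /eqP /ps_mul_eq0 [//|/eqP].
by rewrite subr_eq0 => /eqP.
Qed.

(** * Substitution into a series *)

Section Subst.
Variables (R : comNzRingType) (g : ps R).

Hypothesis g0 : g 0%N = 0.

Lemma val_exp k n : (n < k)%N -> (g ^+ k) n = 0.
Proof.
elim: k n => // k IH n nk; rewrite exprS psME big1 // => -[[|i] il] _ /=.
  by rewrite g0 mul0r.
by rewrite IH ?mulr0 //; lia.
Qed.

(** The outer variable of [F] is replaced by [g], whose own variable is that of the coefficients;
    [g ^+ k] has order at least [k], so coefficient [n] needs only [k <= n]. Applied to [psmap psC]
    of a series, this is ordinary composition. *)
Definition psub (F : ps (ps R)) : ps R := fun n => (\sum_(k < n.+1) F k * g ^+ k) n.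

Lemma val_mulexp (f : ps R) k n : (n < k)%N -> (f * g ^+ k) n = 0.
Proof.
move=> nk; rewrite psME big1 // => i _; rewrite val_exp ?mulr0 //; lia.
Qed.

Lemma psubE N F n : (n < N)%N -> psub F n = (\sum_(k < N) F k * g ^+ k) n.
Proof.
move=> nN; rewrite /psub !ps_sumE -(big_mkord xpredT (fun k => (F k * g ^+ k) n)).
rewrite -(big_mkord xpredT (fun k => (F k * g ^+ k) n)) (@big_cat_nat _ _ _ n.+1 0 N) //=.
rewrite [X in _ = _ + X]big_nat_cond [X in _ = _ + X]big1 ?addr0 // => i /andP[/andP[ni _] _].
exact: val_mulexp.
Qed.

Fact psub_zmod : zmod_morphism psub.
Proof.
move=> F G; apply: psP => n; rewrite psBE /psub -psBE -sumrB; congr (_ n).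
by apply: eq_bigr => i _; rewrite -mulrBl.
Qed.

Lemma psubM F G : psub (F * G) = psub F * psub G.
Proof.
apply: psP => n; pose N := n.+1.
have e H : eqm N (psub H) (\sum_(k < N) H k * g ^+ k).
  by move=> i iN; apply: psubE.
rewrite (eqmM (e F) (e G)) // big_distrlr /= (e _ n) //.
rewrite !ps_sumE.
transitivity (\sum_(k < N) \sum_(i < N | (i <= k)%N) (F i * G (k - i)%N * g ^+ k) n).
  apply: eq_bigr => k _; rewrite [(F * G) k]psME mulr_suml ps_sumE.
  rewrite -(big_mkord xpredT (fun i => (F i * G (k - i)%N * g ^+ k) n)).
  rewrite (big_nat_widen _ _ N) ?big_mkord; last exact: ltn_ord.
  by apply: eq_bigl => i; rewrite ltnS.
rewrite (exchange_big_dep xpredT) //=; apply: eq_bigr => -[i iN] _ /=.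
rewrite ps_sumE.
transitivity (\sum_(i <= k < N) (F i * G (k - i)%N * g ^+ k) n).
  rewrite [RHS]big_nat_cond -(big_mkord (fun k => (i <= k)%N) (fun k => (F i * G (k - i)%N * g ^+ k) n)).
  rewrite [RHS](big_nat_widenl _ 0%N) // [LHS]big_nat_cond; apply: eq_bigl => k.
  by case: (i <= k)%N; case: (k < N)%N; rewrite ?andbF ?andbT.
rewrite -[X in \sum_(X <= _ < _) _]add0n big_addn.
rewrite -(big_mkord xpredT (fun j => (F i * g ^+ i * (G j * g ^+ j)) n)).
rewrite [RHS](@big_cat_nat _ _ _ (N - i)%N) //=; last by lia.
rewrite [X in _ = _ + X]big_nat_cond [X in _ = _ + X]big1 ?addr0 => [|j /andP[/andP[ji _] _]].
  apply: eq_bigr => j _; rewrite addnK exprD.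
  by congr ((_ : ps R) n); rewrite [RHS]mulrACA [g ^+ j * _]mulrC.
(* The leftover pairs satisfy [N <= i + j], so their order exceeds [n]. *)
rewrite (_ : _ * _ = (F i * G j) * g ^+ (i + j)); last by rewrite exprD mulrACA.
by apply: val_mulexp; lia.
Qed.

Lemma psub_const (f : ps R) : psub (psC f) = f.
Proof.
apply: psP => n; rewrite /psub big_ord_recl big1 ?addr0 ?mulr1 // => i _.
by rewrite mul0r.
Qed.

Fact psub_monoid : monoid_morphism psub.
Proof. by split; [rewrite -[X in psub X](rmorph1 (psC (R := ps R))) psub_const | exact: psubM]. Qed.

HB.instance Definition _ := GRing.isZmodMorphism.Build (ps (ps R)) (ps R) psub psub_zmod.
HB.instance Definition _ := GRing.isMonoidMorphism.Build (ps (ps R)) (ps R) psub psub_monoid.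

Definition psubm : {rmorphism ps (ps R) -> ps R} := psub.

End Subst.

Section Map.
Variables (R S : comNzRingType) (phi : {rmorphism R -> S}).

Definition psmap (f : ps R) : ps S := fun n => phi (f n).

Fact psmap_zmod : zmod_morphism psmap.
Proof. by move=> f g; apply: psP => n; rewrite /psmap psBE rmorphB. Qed.
Fact psmap_monoid : monoid_morphism psmap.
Proof.
split; first by apply: psP => n; rewrite /psmap !ps1E rmorph_nat.
move=> f g; apply: psP => n; rewrite /psmap psME rmorph_sum.
by apply: eq_bigr => i _; rewrite rmorphM.
Qed.
HB.instance Definition _ := GRing.isZmodMorphism.Build (ps R) (ps S) psmap psmap_zmod.
HB.instance Definition _ := GRing.isMonoidMorphism.Build (ps R) (ps S) psmap psmap_monoid.
End Map.

(** * Polynomials and quotients evaluated at series *)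

Section Eval.
Implicit Types f g : ps K.

Lemma fps_mulE f g : fps_mul f g = f * g :> ps K. Proof. by []. Qed.

Lemma fps_powE f k : fps_pow f k = f ^+ k :> ps K.
Proof. by elim: k => //= k IH; rewrite exprS -IH. Qed.

Definition psev (z : ps K) : {poly K} -> ps K := horner_eval z \o map_poly (psC (R := K)).
Definition psev2 (z v : ps K) : {poly {poly K}} -> ps K := horner_eval v \o map_poly (psev z).

HB.instance Definition _ z := GRing.RMorphism.on (psev z).
HB.instance Definition _ z v := GRing.RMorphism.on (psev2 z v).

Lemma pevalE q (z : ps K) : peval q z = psev z q :> ps K.
Proof.
apply: psP => n; rewrite /peval /psev /= /horner_eval horner_coef size_map_poly ps_sumE.
by apply: eq_bigr => j _; rewrite coef_map /= psC_mulE fps_powE.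
Qed.

Lemma eval2E p (z v : ps K) : eval2 p z v = psev2 z v p :> ps K.
Proof.
apply: psP => n; rewrite /eval2 /psev2 /= /horner_eval (@horner_coef_wide _ (size p)) ?size_poly //.
rewrite ps_sumE; apply: eq_bigr => j _.
by rewrite coef_map /= fps_mulE fps_powE pevalE.
Qed.

Lemma fps_compE f (z : ps K) : z 0%N = 0 -> fps_comp f z = psub z (psmap (psC (R := K)) f) :> ps K.
Proof.
move=> z0; apply: psP => n; rewrite /fps_comp /psub ps_sumE.
by apply: eq_bigr => k _; rewrite /psmap psC_mulE fps_powE.
Qed.

Lemma size_inv_seq f n : size (inv_seq f n) = n.+1.
Proof. by elim: n => //= n IH; rewrite size_rcons IH. Qed.

Lemma nth_inv_seq f n i : (i <= n)%N -> nth 0 (inv_seq f n) i = fps_inv f i.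
Proof.
elim: n => [|n IH]; first by case: i.
rewrite leq_eqVlt => /predU1P [-> //|lin].
by rewrite /= nth_rcons size_inv_seq lin IH.
Qed.

Lemma fps_invP f : f 0%N != 0 -> f * (fps_inv f : ps K) = 1.
Proof.
move=> f0; apply: psP => -[|n]; first by rewrite psM0 /fps_inv /= mulfV.
rewrite psME big_ord_recl subn0 {1}/fps_inv.
have -> : nth 0 (inv_seq f n.+1) n.+1 = - (f 0%N)^-1 * \sum_(i < n.+1) f i.+1 * nth 0 (inv_seq f n) (n - i)%N.
  by rewrite /= nth_rcons size_inv_seq ltnn eqxx.
rewrite mulrA mulrN mulfV // mulN1r ps1E addrC; apply/eqP; rewrite subr_eq0; apply/eqP.
apply: eq_bigr => i _; rewrite nth_inv_seq ?leq_subr //; congr (_ * _).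
Qed.

Lemma fps_divP f g h : g 0%N != 0 -> f = g * h -> fps_div f g = h :> ps K.
Proof.
move=> g0 ->; rewrite /fps_div fps_mulE mulrAC -[g * _]/(g * (fps_inv g : ps K)).
by rewrite fps_invP // mul1r.
Qed.

End Eval.

Lemma psT_exp (R : comNzRingType) k n : (psT ^+ k : ps R) n = (n == k)%:R.
Proof.
elim: k n => [|k IH] [|n]; rewrite ?exprS ?psT_mul0 ?psT_mulS ?IH //.
Qed.

Lemma psub_T (R : comNzRingType) (f : ps R) : psub psT (psmap (psC (R := R)) f) = f.
Proof.
apply: psP => n; rewrite /psub ps_sumE (bigD1 ord_max) //= big1 ?addr0.
  by rewrite psC_mulE psT_exp eqxx mulr1.
move=> i; rewrite psC_mulE psT_exp -val_eqE /= eq_sym => /negPf ->.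
by rewrite mulr0.
Qed.

Lemma psub_psT (R : comNzRingType) (g : ps R) : g 0%N = 0 -> psub g psT = g.
Proof.
move=> g0; apply: psP => n; rewrite (@psubE _ _ g0 n.+2) //.
rewrite 2!big_ord_recl /= big1 => [|i _]; last exact: mul0r.
have [-> ->] : psT 0%N = 0 :> ps R /\ psT (bump 0 0) = 1 :> ps R by [].
by rewrite mul0r mul1r add0r addr0 expr1.
Qed.

Lemma psmap_psT (R S : comNzRingType) (phi : {rmorphism R -> S}) : psmap phi psT = psT.
Proof. by apply: psP => n; rewrite /psmap /psT rmorph_nat. Qed.

Lemma psmap_psC (R S : comNzRingType) (phi : {rmorphism R -> S}) (c : R) :
  psmap phi (psC c) = psC (phi c).
Proof. by apply: psP => -[|n]; rewrite /psmap /psC //= rmorph0. Qed.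

Lemma ps_neq0 (R : comNzRingType) (f : ps R) : f 0%N != 0 -> f <> 0.
Proof. by move=> + E; rewrite E eqxx. Qed.

Definition ev0 (R : comNzRingType) (f : ps R) : R := f 0%N.

Fact ev0_zmod (R : comNzRingType) : zmod_morphism (@ev0 R).
Proof. by []. Qed.
Fact ev0_monoid (R : comNzRingType) : monoid_morphism (@ev0 R).
Proof. by split => // f g; apply: psM0. Qed.
HB.instance Definition _ (R : comNzRingType) :=
  GRing.isZmodMorphism.Build (ps R) R (@ev0 R) (@ev0_zmod R).
HB.instance Definition _ (R : comNzRingType) :=
  GRing.isMonoidMorphism.Build (ps R) R (@ev0 R) (@ev0_monoid R).

(** * The kernel method *)

Local Notation A := (ps K).

Definition fser (R : comNzRingType) (x : R) : ps R := fun n => fcoef n x.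
Definition hser (R : comNzRingType) (om : int -> R) (x y : R) : ps R :=
  fun n => hcoef om n x y.

Lemma fser_eq (R : comNzRingType) (x : R) :
  psC (x - 1) * (fser x - 1) = psT * (psC x * (psC x * fser x - fser 1) * fser x).
Proof.
apply: psP => -[|n].
  by rewrite psC_mulE psBE /fser fcoef0 ps1E subrr mulr0 psT_mul0.
rewrite psC_mulE psBE ps1E subr0 fcoefS psT_mulS psME.
by apply: eq_bigr => i _; rewrite psC_mulE psBE psC_mulE.
Qed.

Lemma hser_eq (R : comNzRingType) (om : int -> R) (x y : R) :
  om 0 = 1 -> (forall i j, om (i + j) = om i * om j) ->
  psC (x - 1) * psC (y - 1) * hser om x y =
  psC (x - 1) * psC (y - 1) * (fser y - 1)
  + psC (y - 1) * (psT * (psC x * (psC x * fser x - fser 1) * hser om x y))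
  + psC (y - 1) * (psT * (psC (om 1) * psC x * (psC x * hser om x y - hser om 1 y) * fser y))
  + psC (x - 1) * (psT * (psC (om (-2)) * psC y * (hser om 1 y - hser om 1 1) * fser y)).
Proof.
move=> om0 omD; rewrite -!rmorphM; apply: psP => -[|n].
  rewrite !psDE !psC_mulE !psT_mul0 psBE /fser fcoef0 ps1E subrr /hser hcoef0.
  by rewrite !mulr0 !addr0.
rewrite !psDE !psC_mulE !psT_mulS psBE ps1E subr0 hcoefS // !psME.
congr (_ + _ * _ + _ * _ + _ * _); apply: eq_bigr => i _.
- by rewrite psC_mulE psBE psC_mulE.
- by rewrite psC_mulE psBE psC_mulE.
- by rewrite psC_mulE psBE.
Qed.

Lemma fcoef_rmorph (R S : comNzRingType) (phi : {rmorphism R -> S}) n x :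
  fcoef n (phi x) = phi (fcoef n x).
Proof. by rewrite /fcoef rmorph_sum; apply: eq_bigr => I _; rewrite rmorphXn. Qed.

(** Here [h1], [h2], [h] stand for H(x,y), H(1,y), H(1,1). After multiplication by [x * fx], the
    equation of F makes the coefficient of [h1] a multiple of [x - 1 - t p x^2 fx fy], which the
    first kernel equation kills; the second one then kills [h2]. Up to factors,
    [(y - 1) (fy - 1) = t q y h fy] remains, and the equation of F at [y] turns it into
    [q h = y fy - f1]. *)
Lemma kernel_algebra (R : comNzRingType) (x y t p q fx fy f1 h1 h2 h : R) :
  (x - 1) * (fx - 1) = t * (x * (x * fx - f1) * fx) ->
  (y - 1) * (fy - 1) = t * (y * (y * fy - f1) * fy) ->
  (x - 1) * (y - 1) * h1 = (x - 1) * (y - 1) * (fy - 1)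
    + (y - 1) * (t * (x * (x * fx - f1) * h1))
    + (y - 1) * (t * (p * x * (x * h1 - h2) * fy))
    + (x - 1) * (t * (q * y * (h2 - h) * fy)) ->
  x - 1 = t * p * x * fx * (x * fy) ->
  y - 1 = t * q * x * fx * (y * fy) ->
  (y - 1) * ((x - 1) * (q * h)) = (y - 1) * ((x - 1) * (y * fy - f1)).
Proof.
pose L := (x - 1) * (y - 1) * h1 - ((x - 1) * (y - 1) * (fy - 1)
    + (y - 1) * (t * (x * (x * fx - f1) * h1))
    + (y - 1) * (t * (p * x * (x * h1 - h2) * fy))
    + (x - 1) * (t * (q * y * (h2 - h) * fy))).
pose L1 := (x - 1) * (fx - 1) - t * (x * (x * fx - f1) * fx).
pose L2 := (y - 1) * (fy - 1) - t * (y * (y * fy - f1) * fy).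
pose L3 := x - 1 - t * p * x * fx * (x * fy).
pose L4 := y - 1 - t * q * x * fx * (y * fy).
move=> /eqP; rewrite -subr_eq0 -/L1 => /eqP E1.
move=> /eqP; rewrite -subr_eq0 -/L2 => /eqP E2.
move=> /eqP; rewrite -subr_eq0 -/L => /eqP E.
move=> /eqP; rewrite -subr_eq0 -/L3 => /eqP E3.
move=> /eqP; rewrite -subr_eq0 -/L4 => /eqP E4.
apply/eqP; rewrite -subr_eq0; apply/eqP.
transitivity (q * (x * fx * L - (y - 1) * x * h1 * L1
     - (y - 1) * (x * h1 - h2) * L3 - (x - 1) * (h2 - h) * L4)
   + (x - 1) * (q * x * fx * L2 - (y * fy - f1) * L4)); last first.
  by rewrite E E1 E2 E3 E4; ring.
by rewrite /L /L1 /L2 /L3 /L4; ring.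
Qed.

(** With [X a^2 = 1 + v] the functional equation reduces to the polynomial identity [J]; [s] and [p]
    are the inverses of [1 + z v] and [1 - z]. The term [(1 - 2 * z) * p ^+ 3] is [G] at [v = 0],
    the parameter of [X = 1]. *)
Lemma param_algebra (R : comNzRingType) (X t z p v s : R) :
  t = z * (1 - z) ^+ 3 -> v = X * (1 + z * v) ^+ 2 - 1 ->
  (1 + z * v) * s = 1 -> (1 - z) * p = 1 ->
  let G := (1 + z * v) * (1 - 2 * z - z ^+ 2 * v) * p ^+ 3 in
  (X - 1) * (G - 1) = t * (X * (X * G - (1 - 2 * z) * p ^+ 3) * G).
Proof.
move=> -> Ev E1 E2 G; pose a := 1 + z * v; pose b := 1 - z.
pose q := 1 - 2 * z - z ^+ 2 * v.
have Ea : X * a ^+ 2 = 1 + v by rewrite [in RHS]Ev /a; ring.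
have J : (1 + v - a ^+ 2) * (a * q - b ^+ 3) =
    z * (1 + v) * ((1 + v) * q - (1 - 2 * z) * a) * q by rewrite /a /b /q; ring.
rewrite -Ea in J.
transitivity ((a * s) ^+ 2 * ((X - 1) * (a * q * p ^+ 3 - (b * p) ^+ 3))).
  by rewrite E1 E2 /G /a /q; ring.
transitivity (s ^+ 2 * p ^+ 3 * ((X * a ^+ 2 - a ^+ 2) * (a * q - b ^+ 3))).
  by move: (a) (b) (q) => a' b' q'; ring.
rewrite J.
transitivity ((a * s) ^+ 2 * (z * X * p ^+ 3 * (X * a * q - (1 - 2 * z)) * a * q)).
  by move: (a) (b) (q) => a' b' q'; ring.
rewrite E1 expr1n mul1r.
transitivity ((b * p) ^+ 3 * (z * X * p ^+ 3 * (X * a * q - (1 - 2 * z)) * a * q)).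
  by rewrite E2; ring.
by rewrite /G /a /b /q; ring.
Qed.

(* When [x 0 = 1], the constant terms of the coefficients of F(x) are those of F(1),
   so that [ev] recovers F(1) from F(x). *)
Definition ev : ps A -> ps A := psmap (psC (R := K)) \o psmap (@ev0 K).
HB.instance Definition _ := GRing.RMorphism.on ev.

Lemma fser_ev (x : A) : x 0%N = 1 -> fser (1 : A) = ev (fser x).
Proof.
move=> x0; apply: psP => n; rewrite /ev /= /psmap /fser.
have e0 : ev0 x = 1 := x0.
by rewrite -(fcoef_rmorph (@ev0 K)) -(fcoef_rmorph (psC (R := K))) /= e0 rmorph1.
Qed.

(** With F(1) replaced by [ev f], the equation mentions [f] alone. Its right side carries a factor
    of the outer variable, so the earlier coefficients determine coefficient [n] once [x - 1] is
    cancelled. *)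
Lemma fser_unique (x : A) (f : ps A) : x 0%N = 1 -> x <> 1 ->
  psC (x - 1) * (f - 1) = psT * (psC x * (psC x * f - ev f) * f) -> fser x = f.
Proof.
move=> x0 x1 Ef; have Eg := fser_eq x; rewrite (fser_ev x0) in Eg.
have x10 : x - 1 <> 0 by move/eqP; rewrite subr_eq0 => /eqP.
suff H n : eqm n (fser x) f by apply: psP => n; apply: (H n.+1).
elim: n => // n IH i; rewrite ltnS leq_eqVlt => /predU1P[-> {i}|/IH //].
have Eev : eqm n (ev (fser x)) (ev f).
  by move=> i /IH E; rewrite /ev /= /psmap E.
have : eqm n.+1 (psC (x - 1) * (fser x - 1)) (psC (x - 1) * (f - 1)).
  rewrite Ef Eg; apply: eqm_mulS => //.
  by apply: eqmM => //; apply: eqmM => //; apply: eqmD; [apply: eqmM|apply: eqmN].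
move=> /(_ n (ltnSn n)); rewrite !psC_mulE !psBE => /(ps_mulI x10).
by move/addIr.
Qed.

Definition Fs (x : A) : A := psub psT (fser x).
Definition Hs (om : int -> A) (x y : A) : A := psub psT (hser om x y).

(* Here x is a series in an auxiliary variable, which [psubT] identifies with t. *)
Definition psubT : {rmorphism ps A -> A} := @psubm K psT erefl.

Lemma psubTC (c : A) : psubT (psC c) = c.
Proof. exact: psub_const. Qed.

Lemma psubT_T : psubT psT = psT.
Proof. exact: psub_psT. Qed.

Lemma Fs_eq (x : A) : (x - 1) * (Fs x - 1) = psT * (x * (x * Fs x - Fs 1) * Fs x).
Proof.
have := congr1 psubT (fser_eq x).
by rewrite !(rmorphM, rmorphB, rmorph1, psubTC, psubT_T).
Qed.

Lemma Hs_eq (om : int -> A) (x y : A) :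
  om 0 = 1 -> (forall i j, om (i + j) = om i * om j) ->
  (x - 1) * (y - 1) * Hs om x y =
  (x - 1) * (y - 1) * (Fs y - 1)
  + (y - 1) * (psT * (x * (x * Fs x - Fs 1) * Hs om x y))
  + (y - 1) * (psT * (om 1 * x * (x * Hs om x y - Hs om 1 y) * Fs y))
  + (x - 1) * (psT * (om (-2) * y * (Hs om 1 y - Hs om 1 1) * Fs y)).
Proof.
move=> om0 omD; have := congr1 psubT (hser_eq x y om0 omD); rewrite /Hs /Fs.
move: (hser om x y) (hser om 1 y) (hser om 1 1) (fser x) (fser y) (fser 1) => a b c d e f.
by rewrite !(rmorphM, rmorphB, rmorphD, rmorph1, psubTC, psubT_T).
Qed.

Lemma kernel_method (om : int -> A) (x y : A) :
  om 0 = 1 -> (forall i j, om (i + j) = om i * om j) ->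
  x <> 1 -> y <> 1 ->
  x - 1 = psT * om 1 * x * Fs x * (x * Fs y) ->
  y - 1 = psT * om (-2) * x * Fs x * (y * Fs y) ->
  om (-2) * Hs om 1 1 = y * Fs y - Fs 1.
Proof.
move=> om0 omD x1 y1 ex ey.
have x10 : x - 1 <> 0 by move/eqP; rewrite subr_eq0 => /eqP.
have y10 : y - 1 <> 0 by move/eqP; rewrite subr_eq0 => /eqP.
apply: (ps_mulI x10); apply: (ps_mulI y10).
exact: kernel_algebra (Fs_eq x) (Fs_eq y) (Hs_eq x y om0 omD) ex ey.
Qed.

(** * Rational parametrization of F *)

Section Param.
Variables (z : A) (z0 : z 0%N = 0) (zT : z * (1 - z) ^+ 3 = psT).

Lemma one_minus_z : (1 - z) 0%N = 1.
Proof. by rewrite psBE ps1E z0 subr0. Qed.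

(** Uniqueness is available while the variable of [x] and that of F are kept apart. So [z] is copied
    into the outer variable as [cz], a parameter [v] is built over it, F is identified with [G]
    there, and only then does [psubT] merge the two variables. *)
Lemma Fs_param (x u : A) : x 0%N = 1 -> x <> 1 -> u = x * (1 + z * u) ^+ 2 - 1 ->
  (1 - z) ^+ 3 * Fs x = (1 + z * u) * (1 - 2 * z - z ^+ 2 * u)
  /\ (1 - z) ^+ 3 * Fs 1 = 1 - 2 * z.
Proof.
move=> x0 x1 Eu; pose cz : ps A := psmap (psC (R := K)) z.
have cz0 : cz 0%N = 0 by rewrite /cz /psmap z0 rmorph0.
have [|uu /(_ tt) Ev] := @contraction_fix A unit (fun v _ => psC x * (1 + cz * v tt) ^+ 2 - 1).
  move=> n v v' vv _; apply: eqmD => //.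
  apply: eqmM => //; apply: eqmX; apply: eqmD => //.
  by apply: eqm_mulS => //; apply: vv.
move: (uu tt) Ev => v Ev {uu}.
have [p [pz p0]] := ps_inv_exists one_minus_z.
pose cp : ps A := psmap (psC (R := K)) p.
have cpz : (1 - cz) * cp = 1 by rewrite /cz /cp -(rmorph1 (psmap (psC (R := K)))) -rmorphB -rmorphM pz.
have czT : psT = cz * (1 - cz) ^+ 3.
  by rewrite /cz -(rmorph1 (psmap (psC (R := K)))) -rmorphB -rmorphXn -rmorphM zT; exact/esym/psmap_psT.
have [s [sv _]] : exists s, (1 + cz * v) * s = 1 /\ s 0%N = 1.
  by apply: ps_inv_exists; rewrite psDE psM0 cz0 mul0r addr0.
pose G := (1 + cz * v) * (1 - 2 * cz - cz ^+ 2 * v) * cp ^+ 3.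
have evc (f : A) : ev (psmap (psC (R := K)) f) = psmap (psC (R := K)) f.
  by apply: psP.
(* Under [ev] the series [x] becomes 1 and the parameter solves [g = (1 + z g)^2 - 1]. This factors
   as [g] times a series of constant term 1, so [g = 0]. *)
have evv : ev v = 0.
  pose g := psmap (@ev0 K) v.
  have Eg : g = (1 + z * g) ^+ 2 - 1.
    have e1 : psmap (@ev0 K) (psC x) = 1.
      by apply: psP => -[|n]; [exact: x0 | rewrite /psmap /= rmorph0].
    have e2 : psmap (@ev0 K) cz = z by apply: psP.
    rewrite /g [in LHS]Ev rmorphB rmorphM rmorphXn rmorphD rmorphM rmorph1.
    by rewrite -[X in _ = X - 1]mul1r; congr (_ * (1 + _ * _) ^+ 2 - 1).
  suff g0 : g = 0 by rewrite /ev /= -/g g0 rmorph0.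
  have /ps_mul_eq0 [//|H] : g * (1 - z * (2 + z * g)) = 0.
    transitivity (g - ((1 + z * g) ^+ 2 - 1)); last by rewrite -Eg subrr.
    by move: (g) => g'; ring.
  by case: (@ps_neq0 _ _ _ H); rewrite psBE psM0 z0 mul0r subr0 oner_neq0.
have evG : ev G = (1 - 2 * cz) * cp ^+ 3.
  rewrite /G !(rmorphM, rmorphB, rmorphXn, rmorphD, rmorph1, rmorph_nat) /= !evc evv.
  by rewrite !mulr0 addr0 mul1r subr0.
have FG : fser x = G.
  apply: fser_unique => //; rewrite evG /G.
  rewrite rmorphB rmorph1; exact: param_algebra czT Ev sv cpz.
have F1G : fser (1 : A) = (1 - 2 * cz) * cp ^+ 3 by rewrite (fser_ev x0) FG.
have ezc (f : A) : psubT (psmap (psC (R := K)) f) = f by apply: psub_T.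
have bp : (1 - z) ^+ 3 * p ^+ 3 = 1 by rewrite -exprMn pz expr1n.
split; last first.
  rewrite /Fs -/(psubT (fser 1)) F1G !(rmorphM, rmorphB, rmorphXn, rmorph1, rmorph_nat) !ezc.
  by rewrite mulrCA bp mulr1.
rewrite /Fs -/(psubT (fser x)) FG /G.
have EU := congr1 psubT Ev.
rewrite !(rmorphM, rmorphB, rmorphXn, rmorphD, rmorph1, rmorph_nat) !ezc psubTC in EU *.
set U := psubT v in EU *.
(* Both solve the same quadratic; the difference of the two equations is [U - u] times a series of
   constant term 1. *)
suff -> : U = u by rewrite mulrCA bp mulr1.
have /ps_mul_eq0 [|H] : (U - u) * (1 - x * z * (2 + z * (U + u))) = 0.
- transitivity ((U - (x * (1 + z * U) ^+ 2 - 1)) - (u - (x * (1 + z * u) ^+ 2 - 1))).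
    by move: (U) => U'; ring.
  by rewrite -EU -Eu !subrr.
- by move/eqP; rewrite subr_eq0 => /eqP.
by case: (@ps_neq0 _ _ _ H); rewrite psBE !psM0 z0 mulr0 mul0r subr0 oner_neq0.
Qed.
End Param.

(** * Elimination *)

Definition Scoef0 (R : comNzRingType) (z c : R) : R :=
  z - 2 * z ^+ 2.
Definition Scoef1 (R : comNzRingType) (z c : R) : R :=
  - (c ^+ 2) + 2 * z + 3 * z * c ^+ 2 - 3 * z ^+ 2 - z ^+ 2 * c - 4 * z ^+ 2 * c ^+ 2
  - 2 * z ^+ 3 + 3 * z ^+ 3 * c + 4 * z ^+ 3 * c ^+ 2.
Definition Scoef2 (R : comNzRingType) (z c : R) : R :=
  - (c ^+ 2) + c ^+ 5 + z + 3 * z * c ^+ 2 + z * c ^+ 3 + z * c ^+ 4 - 4 * z * c ^+ 5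
  - 2 * z ^+ 2 * c - 5 * z ^+ 2 * c ^+ 2 - 5 * z ^+ 2 * c ^+ 3 - 5 * z ^+ 2 * c ^+ 4
  + 4 * z ^+ 2 * c ^+ 5 - 4 * z ^+ 3 + 5 * z ^+ 3 * c + 6 * z ^+ 3 * c ^+ 2
  + 7 * z ^+ 3 * c ^+ 3 + 7 * z ^+ 3 * c ^+ 4 + 4 * z ^+ 4 * c + 4 * z ^+ 4 * c ^+ 2
  - 2 * z ^+ 4 * c ^+ 3 - 2 * z ^+ 4 * c ^+ 4.
Definition Scoef3 (R : comNzRingType) (z c : R) : R :=
  z * c ^+ 3 + z * c ^+ 4 + z * c ^+ 5 + z ^+ 2 - z ^+ 2 * c - z ^+ 2 * c ^+ 2
  - 5 * z ^+ 2 * c ^+ 3 - 5 * z ^+ 2 * c ^+ 4 - 6 * z ^+ 2 * c ^+ 5 - 2 * z ^+ 3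
  + z ^+ 3 * c + z ^+ 3 * c ^+ 2 + 5 * z ^+ 3 * c ^+ 3 + 5 * z ^+ 3 * c ^+ 4
  + 8 * z ^+ 3 * c ^+ 5 + 8 * z ^+ 4 * c + 8 * z ^+ 4 * c ^+ 2 + 3 * z ^+ 4 * c ^+ 3
  + 3 * z ^+ 4 * c ^+ 4 + z ^+ 5 * c + z ^+ 5 * c ^+ 2 - z ^+ 5 * c ^+ 3
  - z ^+ 5 * c ^+ 4.
Definition Scoef4 (R : comNzRingType) (z c : R) : R :=
  - (z ^+ 3 * c) - z ^+ 3 * c ^+ 2 - 2 * z ^+ 3 * c ^+ 3 - 2 * z ^+ 3 * c ^+ 4
  - 2 * z ^+ 3 * c ^+ 5 + 4 * z ^+ 4 * c + 4 * z ^+ 4 * c ^+ 2 + 5 * z ^+ 4 * c ^+ 3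
  + 5 * z ^+ 4 * c ^+ 4 + 5 * z ^+ 4 * c ^+ 5 + 2 * z ^+ 5 * c + 2 * z ^+ 5 * c ^+ 2.
Definition Scoef5 (R : comNzRingType) (z c : R) : R :=
  z ^+ 5 * c + z ^+ 5 * c ^+ 2 + z ^+ 5 * c ^+ 3 + z ^+ 5 * c ^+ 4 + z ^+ 5 * c ^+ 5.

Lemma S_exprE (R : comNzRingType) (v z c : R) : S_expr v z c =
  Scoef0 z c + Scoef1 z c * v + Scoef2 z c * v ^+ 2 + Scoef3 z c * v ^+ 3
  + Scoef4 z c * v ^+ 4 + Scoef5 z c * v ^+ 5.
Proof.
by rewrite /S_expr /Scoef0 /Scoef1 /Scoef2 /Scoef3 /Scoef4 /Scoef5; ring.
Qed.

(** When [z], [v] and [v'] have no constant term, the second factor has constant term that of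
    [- c ^+ 2], which comes from [Scoef1]; this makes the small root of S unique. *)
Lemma S_expr_sub (R : comNzRingType) (v v' z c : R) : exists r1 r2 r3,
  S_expr v z c - S_expr v' z c = (v - v') * (z * r1 + v * r2 + v' * r3 - c ^+ 2).
Proof.
pose c2 := Scoef2 z c; pose c3 := Scoef3 z c; pose c4 := Scoef4 z c; pose c5 := Scoef5 z c.
exists (2 + 3 * c ^+ 2 - 3 * z - z * c - 4 * z * c ^+ 2 - 2 * z ^+ 2
  + 3 * z ^+ 2 * c + 4 * z ^+ 2 * c ^+ 2).
exists (c2 + c3 * (v + v') + c4 * (v ^+ 2 + v * v' + v' ^+ 2)
  + c5 * (v ^+ 3 + v ^+ 2 * v' + v * v' ^+ 2 + v' ^+ 3)).
exists (c2 + c3 * v' + c4 * v' ^+ 2 + c5 * v' ^+ 3).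
by rewrite !S_exprE /Scoef1 /c2 /c3 /c4 /c5; ring.
Qed.

Section Elimination.
Variables (R : comNzRingType) (u v z c d x y t fx fy f1 : R).
Let a := 1 + z * u.
Let a' := 1 + z * v.
Let b := 1 - z.
Let qu := 1 - 2 * z - z ^+ 2 * u.
Let qv := 1 - 2 * z - z ^+ 2 * v.

Hypotheses (Et : t = z * b ^+ 3) (Ex : x * a ^+ 2 = 1 + u) (Ey : y * a' ^+ 2 = 1 + v).
Hypotheses (Efx : b ^+ 3 * fx = a * qu) (Efy : b ^+ 3 * fy = a' * qv).
Hypothesis Ef1 : b ^+ 3 * f1 = 1 - 2 * z.
Hypothesis Eu : a * b ^+ 3 * u = z * c * a' * (1 + u) ^+ 2 * qv.
Hypothesis Ev : a * b ^+ 3 * v = z * d * a' * (1 + u) * (1 + v) * qu.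
Hypothesis cd : c ^+ 2 * d = 1.

(** Since [1 + u - a ^+ 2 = u * qu], the cleared kernel equation is [Eu] multiplied by [a * qu]; in
    the same way [kernel_y] is [Ev] multiplied by [a * qv]. *)
Lemma kernel_x : a ^+ 4 * b ^+ 3 * (x - 1) = a ^+ 4 * b ^+ 3 * (t * c * x * fx * (x * fy)).
Proof.
transitivity (a * qu * (a * b ^+ 3 * u)).
  transitivity (a ^+ 2 * b ^+ 3 * (x * a ^+ 2 - a ^+ 2)); first by ring.
  by rewrite Ex /qu /a; ring.
transitivity (z * c * (x * a ^+ 2) ^+ 2 * (b ^+ 3 * fx) * (b ^+ 3 * fy)); last by rewrite Et; ring.
by rewrite Eu Ex Efx Efy; ring.
Qed.

Lemma kernel_y : a ^+ 2 * a' ^+ 2 * b ^+ 3 * (y - 1) =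
  a ^+ 2 * a' ^+ 2 * b ^+ 3 * (t * d * x * fx * (y * fy)).
Proof.
transitivity (a * qv * (a * b ^+ 3 * v)).
  transitivity (a ^+ 2 * b ^+ 3 * (y * a' ^+ 2 - a' ^+ 2)); first by ring.
  by rewrite Ey /qv /a'; ring.
transitivity (z * d * (x * a ^+ 2) * (y * a' ^+ 2) * (b ^+ 3 * fx) * (b ^+ 3 * fy)); last by rewrite Et; ring.
by rewrite Ev Ex Ey Efx Efy; ring.
Qed.

(** The quotient of [Eu] by [Ev], with [c / d = c ^+ 3]; it supplies one of the two quadratics in
    [u]. *)
Lemma ratio_eq : a * b ^+ 3 * (u * qu * (1 + v)) = a * b ^+ 3 * (c ^+ 3 * v * qv * (1 + u)).
Proof.
transitivity ((a * b ^+ 3 * u) * qu * (1 + v)); first by ring.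
transitivity (c ^+ 3 * (a * b ^+ 3 * v) * qv * (1 + u)); last by ring.
rewrite Eu Ev.
transitivity (z * c * (c ^+ 2 * d) * a' * (1 + u) ^+ 2 * qv * qu * (1 + v)); last by ring.
by rewrite cd mulr1.
Qed.

(* Eliminating [u] between two quadratics in [u]: the combination killing [u ^+ 2] is
   linear, and the resultant is the polynomial of the theorem up to trivial factors. *)
Lemma eliminate : u * qu * (1 + v) = c ^+ 3 * v * qv * (1 + u) ->
  z * b ^+ 4 * v * (c - 1) * c ^+ 2 * S_expr v z c = 0.
Proof.
move=> E1.
pose L1 := u * qu * (1 + v) - c ^+ 3 * v * qv * (1 + u).
have L10 : L1 = 0 by rewrite /L1 E1 subrr.
pose L2 := c ^+ 2 * (a * b ^+ 3 * v) - z * a' * (1 + u) * (1 + v) * qu.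
have L20 : L2 = 0.
  rewrite /L2 Ev; transitivity ((c ^+ 2 * d - 1) * (z * a' * (1 + u) * (1 + v) * qu)).
    by ring.
  by rewrite cd subrr mul0r.
pose e2 := - z ^+ 2 * (1 + v).
pose e1 := (1 - 2 * z) * (1 + v) - c ^+ 3 * v * qv.
pose e0 := - c ^+ 3 * v * qv.
pose al := z * v * b ^+ 3 * c ^+ 2 + z ^+ 3 * ((1 + v) * a') - z * a' * c ^+ 3 * v * qv.
pose be := v * b ^+ 3 * c ^+ 2 - z * ((1 + v) * a') * (1 - 2 * z) - z * a' * c ^+ 3 * v * qv.
have M1 : L1 = e2 * u ^+ 2 + e1 * u + e0 by rewrite /L1 /e2 /e1 /e0 /qu /qv; ring.
have M2 : L2 + z * a' * L1 = al * u + be by rewrite /L1 /L2 /al /be /a /a' /b /qu /qv; ring.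
have res : e2 * be ^+ 2 - e1 * al * be + e0 * al ^+ 2 = 0.
  transitivity (al ^+ 2 * (e2 * u ^+ 2 + e1 * u + e0)
     - (al * u + be) * (e2 * al * u + e1 * al - e2 * be)); first by ring.
  by rewrite -M1 -M2 L10 L20; ring.
apply: oppr_inj; rewrite oppr0 -{}res.
by rewrite S_exprE /Scoef0 /Scoef1 /Scoef2 /Scoef3 /Scoef4 /Scoef5
  /e2 /e1 /e0 /al /be /a' /b /qv; ring.
Qed.

(** The polynomial [Rden] factors as [- a' * b ^+ 3], up to sign the common denominator of [y * fy]
    and [f1]; the factor [c ^+ 2] inverts the weight [d]. *)
Lemma rational_form (m : R) : d * m = y * fy - f1 -> 
  Rden_expr v z c * m = Rnum_expr v z c.
Proof.
move=> Em.
transitivity (c ^+ 2 * d * (Rden_expr v z c * m)); first by rewrite cd mul1r.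
transitivity (- c ^+ 2 * a' * b ^+ 3 * (d * m)).
  by rewrite /Rden_expr /a' /b; ring.
rewrite Em; transitivity (- c ^+ 2 * (y * a' * (b ^+ 3 * fy) - a' * (b ^+ 3 * f1))).
  by ring.
rewrite Efy Ef1; transitivity (- c ^+ 2 * (y * a' ^+ 2 * qv - a' * (1 - 2 * z))).
  by ring.
by rewrite Ey /Rnum_expr /a' /qv; ring.
Qed.

End Elimination.

(** * Algebraicity *)

Local Notation polT := (psev (psT : A)).

Lemma sum_marks (n : nat) (P Q : seq bool) (F : int -> int -> K) :
  (P, Q) \in ints n ->
  \sum_(j < n) F (nth 0 (up_heights Q) j) (nth 0 (up_heights P) j) =
  \sum_(e <- marks P Q) F e.1 e.2.1.
Proof.
move=> PQ; have [/andP[/eqP hP _] /andP[/eqP hQ _] sP sQ] := ints_dyck PQ.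
have s1 : size (ups P) = n.
  by apply: double_inj; rewrite size_ups -dyck_size_even.
have s2 : size (up_heights Q) = n.
  by apply: double_inj; rewrite up_heightsE size_map size_ups -dyck_size_even.
rewrite (big_nth (0, (0, 0%N))) size_zip s1 s2 minnn big_mkord.
apply: eq_bigr => j _; rewrite nth_zip ?s1 ?s2 //=.
by rewrite (up_heightsE P) (nth_map (0, 0%N)) ?s1.
Qed.

Lemma McoefE (n : nat) : Mcoef n =
  \sum_(I <- ints n) \sum_(e <- marks I.1 I.2) w ^ (e.1 - 3 * e.2.1).
Proof.
pose G (I : seq bool * seq bool) : K :=
  \sum_(j < n) w ^ (nth 0 (up_heights I.2) j - 3 * nth 0 (up_heights I.1) j).
transitivity (\sum_(I <- ints n) G I); last first.
  by apply: eq_big_seq => -[P Q] PQ; rewrite /G (sum_marks (fun q p => w ^ (q - 3 * p)) PQ).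
rewrite /Mcoef pair_big_dep /=.
pose v (p : (n.*2).-tuple bool * (n.*2).-tuple bool) := (val p.1, val p.2).
transitivity (\sum_(I <- [seq v p | p <- enum [pred p | v p \in ints n]]) G I).
  by rewrite big_map big_enum /=; apply: eq_bigl => p; rewrite inE mem_ints.
apply: perm_big; apply: uniq_perm; last 1 first.
- move=> [P Q]; apply/mapP/idP => [[p] | PQ].
    by rewrite mem_enum inE => + ->.
  have [_ _ /eqP sP /eqP sQ] := ints_dyck PQ.
  by exists (Tuple sP, Tuple sQ) => //; rewrite mem_enum.
- by rewrite map_inj_uniq ?enum_uniq // => -[? ?] [? ?] [/val_inj -> /val_inj ->].
- exact: uniq_ints.
Qed.

Definition omw (i : int) : A := psC (w ^ i).

Lemma w_neq0 : w != 0.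
Proof. by rewrite /w tofrac_eq0 polyX_eq0. Qed.

Lemma omw0 : omw 0 = 1. Proof. by rewrite /omw expr0z rmorph1. Qed.
Lemma omwD i j : omw (i + j) = omw i * omw j.
Proof. by rewrite /omw expfzDr ?w_neq0 // rmorphM. Qed.

Lemma M11E : M11 = Hs omw 1 1 :> A.
Proof.
rewrite /Hs -[LHS]psub_T; congr (psub _); apply: psP => n.
rewrite /psmap /M11 McoefE /hser /hcoef rmorph_sum; apply: eq_bigr => I _.
rewrite rmorph_sum; apply: eq_bigr => e _.
by rewrite /mono !expr1n !mulr1.
Qed.

(** A monic equation of [D], freed of its factors ['X], has a nonzero constant coefficient, and the
    equation exhibits this coefficient as a multiple of [D]. *)
Lemma integral_annihilate (D : A) : integralOver polT D -> D <> 0 ->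
  exists d E, [/\ d != 0, integralOver polT E & D * E = polT d].
Proof.
move=> [q mq rq] D0.
elim: {q}(size q) {-2}q (leqnn (size q)) mq rq => [|n IH] q.
  by rewrite leqn0 size_poly_eq0 => /eqP -> /monic_neq0; rewrite eqxx.
move=> sq mq rq.
have Eq : q = (q`_0)%:P + drop_poly 1 q * 'X.
  rewrite -[LHS](poly_take_drop 1) expr1; congr (_ + _).
  by apply/polyP => -[|i]; rewrite coef_take_poly coefC.
set r := drop_poly 1 q in Eq.
have Dr : polT q`_0 + D * (map_poly polT r).[D] = 0.
  move/eqP: rq; rewrite {1}Eq rmorphD rmorphM /= map_polyC map_polyX !hornerE /=.
  by rewrite mulrC.
case: (eqVneq q`_0 0) => [q0|q0].
  have Eqr : q = r * 'X by rewrite Eq q0 polyC0 add0r.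
  have r0 : r != 0 by apply: contraTneq mq => r0; rewrite Eqr r0 mul0r monicE lead_coef0 eq_sym oner_eq0.
  apply: (IH r).
  - by move: sq; rewrite Eqr size_mulX.
  - by move: mq; rewrite Eqr monicMr ?monicX.
  - move: Dr; rewrite q0 rmorph0 add0r => /ps_mul_eq0 [//|H]; exact/eqP.
exists q`_0, (- (map_poly polT r).[D]); split=> //.
  apply: integral_opp; apply: integral_horner; last by exists q.
  by apply/integral_poly => i; rewrite coef_map; apply: integral_id.
by rewrite mulrN; apply/eqP; rewrite eq_sym -subr_eq0 opprK Dr.
Qed.

(** From [D * E = polT d] the series [polT d * M = E * N] is integral; composing its monic equation
    with [d *: 'X] gives a nonzero equation for [M]. *)
Lemma quotient_algebraic (D N M : A) : integralOver polT D -> integralOver polT N ->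
  D <> 0 -> D * M = N -> fps_algebraic M.
Proof.
move=> iD iN D0 DM; have [d [E [d0 iE DE]]] := integral_annihilate iD D0.
have [q mq rq] : integralOver polT (polT d * M).
  by rewrite -DE mulrAC DM; apply: integral_mul.
exists (q \Po (d *: 'X)); split.
  rewrite comp_poly_eq0 ?monic_neq0 //.
  by rewrite size_scale // size_polyX.
move=> n; rewrite eval2E /psev2 /= /horner_eval map_comp_poly horner_comp.
rewrite linearZ /= map_polyX hornerZ hornerX.
by move/eqP: rq => ->.
Qed.

Lemma integralX (x : A) k : integralOver polT x -> integralOver polT (x ^+ k).
Proof.
by move=> ix; elim: k => [|k IH]; rewrite ?exprS; [apply: integral1 | apply: integral_mul].
Qed.

Ltac integral := repeat first [ assumption | apply: integral1 | apply: integral_nat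
  | apply: integral_opp | apply: integral_add | apply: integralX | apply: integral_mul ].

Lemma integral_w : integralOver polT (psC w).
Proof.
have -> : psC w = polT (w%:P) by rewrite /psev /= map_polyC /horner_eval hornerC.
exact: integral_id.
Qed.

Lemma integral_z (z : A) : z * (1 - z) ^+ 3 = psT -> integralOver polT z.
Proof.
(* The monic form uses [(z - 1)^3 = - (1 - z)^3], whence the plus sign before [t]. *)
move=> zT; exists ('X * ('X - 1%:P) ^+ 3 + ('X%:P)).
  have s : size ('X * ('X - 1%:P) ^+ 3 : {poly {poly K}}) = 5%N.
    by rewrite mulrC size_mulX ?size_exp_XsubC // expf_neq0 // polyXsubC_eq0.
  rewrite monicE lead_coefDl ?lead_coefM ?lead_coefX ?lead_coef_exp ?lead_coefXsubC ?expr1n ?mul1r //.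
  by rewrite s size_polyC polyX_eq0.
rewrite rootE rmorphD rmorphM rmorphXn rmorphB /= map_polyX !map_polyC /= rmorph1.
rewrite hornerD hornerM horner_exp hornerXsubC hornerX hornerC.
have -> : polT 'X = psT by rewrite /psev /= map_polyX /horner_eval hornerX.
rewrite -zT; apply/eqP.
by move: (z) => z'; ring.
Qed.

(** Multiplied by [c5 ^+ 4], the equation becomes monic in [c5 * v]. *)
Lemma scaled_root_integral (v c0 c1 c2 c3 c4 c5 : A) :
  integralOver polT c0 -> integralOver polT c1 -> integralOver polT c2 ->
  integralOver polT c3 -> integralOver polT c4 -> integralOver polT c5 ->
  c0 + c1 * v + c2 * v ^+ 2 + c3 * v ^+ 3 + c4 * v ^+ 4 + c5 * v ^+ 5 = 0 ->
  integralOver polT (c5 * v).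
Proof.
move=> i0 i1 i2 i3 i4 i5 E.
pose s := [:: c0 * c5 ^+ 4; c1 * c5 ^+ 3; c2 * c5 ^+ 2; c3 * c5; c4; 1].
have Ps : Poly s = s :> seq A by rewrite (@PolyK _ 0) // oner_neq0.
apply: (@integral_root_monic _ _ _ _ (Poly s)).
- by rewrite monicE lead_coefE Ps.
- rewrite rootE horner_Poly /=; apply/eqP.
  transitivity (c5 ^+ 4 * (c0 + c1 * v + c2 * v ^+ 2 + c3 * v ^+ 3 + c4 * v ^+ 4 + c5 * v ^+ 5)).
    by move: (v) (c0) (c1) (c2) (c3) (c4) (c5) => ? ? ? ? ? ? ?; ring.
  by rewrite E mulr0.
- move=> x; rewrite Ps !inE => /or4P[/eqP->|/eqP->|/eqP->|/or3P[/eqP->|/eqP->|/eqP->]]; integral.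
Qed.

(** * The bi-height series *)


Lemma ps_mul_neq0 (f g : A) : f <> 0 -> g <> 0 -> f * g <> 0.
Proof. by move=> f0 g0 /ps_mul_eq0 []. Qed.

Lemma rmorph_S_expr (R S : comNzRingType) (phi : {rmorphism R -> S}) (v z c : R) :
  phi (S_expr v z c) = S_expr (phi v) (phi z) (phi c).
Proof.
by rewrite /S_expr; ring.
Qed.

Lemma rmorph_Rnum_expr (R S : comNzRingType) (phi : {rmorphism R -> S}) (v z c : R) :
  phi (Rnum_expr v z c) = Rnum_expr (phi v) (phi z) (phi c).
Proof.
by rewrite /Rnum_expr; ring.
Qed.

Lemma rmorph_Rden_expr (R S : comNzRingType) (phi : {rmorphism R -> S}) (v z c : R) :
  phi (Rden_expr v z c) = Rden_expr (phi v) (phi z) (phi c).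
Proof.
by rewrite /Rden_expr; ring.
Qed.

Lemma psev_X (z : A) : psev z 'X = z.
Proof. by rewrite /psev /= map_polyX /horner_eval hornerX. Qed.

Lemma psev_C (z : A) (c : K) : psev z c%:P = psC c.
Proof. by rewrite /psev /= map_polyC /horner_eval hornerC. Qed.

Lemma psev2_v (z v : A) : psev2 z v 'X = v.
Proof. by rewrite /psev2 /= map_polyX /horner_eval hornerX. Qed.

Lemma psev2_z (z v : A) : psev2 z v ('X)%:P = z.
Proof. by rewrite /psev2 /= map_polyC /horner_eval hornerC; apply: psev_X. Qed.

Lemma psev2_c (z v : A) (c : K) : psev2 z v (c%:P)%:P = psC c.
Proof. by rewrite /psev2 /= map_polyC /horner_eval hornerC; apply: psev_C. Qed.

Lemma psev2_Spoly (z v : A) : psev2 z v Spoly = S_expr v z (psC w).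
Proof.
transitivity (S_expr (psev2 z v 'X) (psev2 z v ('X)%:P) (psev2 z v (w%:P)%:P)).
  exact: rmorph_S_expr.
by rewrite psev2_v psev2_z psev2_c.
Qed.

Lemma psev2_Rnum (z v : A) : psev2 z v Rnum = Rnum_expr v z (psC w).
Proof.
transitivity (Rnum_expr (psev2 z v 'X) (psev2 z v ('X)%:P) (psev2 z v (w%:P)%:P)).
  exact: rmorph_Rnum_expr.
by rewrite psev2_v psev2_z psev2_c.
Qed.

Lemma psev2_Rden (z v : A) : psev2 z v Rden = Rden_expr v z (psC w).
Proof.
transitivity (Rden_expr (psev2 z v 'X) (psev2 z v ('X)%:P) (psev2 z v (w%:P)%:P)).
  exact: rmorph_Rden_expr.
by rewrite psev2_v psev2_z psev2_c.
Qed.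

Lemma S_expr_unique (z v v' : A) : z 0%N = 0 -> v 0%N = 0 -> v' 0%N = 0 ->
  S_expr v z (psC w) = 0 -> S_expr v' z (psC w) = 0 -> v = v'.
Proof.
move=> z0 v0 v0' E E'.
have [r1 [r2 [r3 E1]]] := S_expr_sub v v' z (psC w).
have /ps_mul_eq0 [|] : (v - v') * (z * r1 + v * r2 + v' * r3 - psC w ^+ 2) = 0.
- by rewrite -E1 E E' subrr.
- by move/eqP; rewrite subr_eq0 => /eqP.
move=> H; case: (@ps_neq0 _ _ _ H).
rewrite psBE !psDE !psM0 z0 v0 v0' !mul0r !add0r oppr_eq0 psX0 expf_neq0 //.
exact: w_neq0.
Qed.

Ltac solve_eqm := repeat first [ assumption | exact: eqm_refl | apply: eqmD
  | apply: eqmN | apply: eqmX | apply: eqmM ].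

(** These are the kernel equations solved for [u] and [v], with [p] meant as the inverse of [1 - z].
    Taking the inverse [s] of [1 + z u] as a third unknown keeps the right sides polynomial, and the
    factor [z] makes the system contracting. *)
Lemma catalytic_system (z p c d : A) : z 0%N = 0 ->
  exists u v s : A, [/\ u = z * (c * (1 + z * v) * (1 + u) ^+ 2
         * (1 - 2 * z - z ^+ 2 * v) * s * p ^+ 3),
    v = z * (d * (1 + z * v) * (1 + u) * (1 + v)
         * (1 - 2 * z - z ^+ 2 * u) * s * p ^+ 3) &
    s = 1 - z * (u * s)].
Proof.
move=> z0.
pose Phi (f : option bool -> A) (i : option bool) : A :=
  let u := f (Some true) in let v := f (Some false) in let s := f None in
  match i with
  | Some true => z * (c * (1 + z * v) * (1 + u) ^+ 2 * (1 - 2 * z - z ^+ 2 * v) * s * p ^+ 3)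
  | Some false => z * (d * (1 + z * v) * (1 + u) * (1 + v) * (1 - 2 * z - z ^+ 2 * u) * s * p ^+ 3)
  | None => 1 - z * (u * s)
  end.
have [n f g fg|f Ef] := @contraction_fix _ _ Phi.
  have := (fg None); have := (fg (Some true)); have := (fg (Some false)) => H1 H2 H3.
  case=> [[]|]; rewrite /Phi /=; [| |apply: eqmD => //; apply: eqmN];
  by apply: eqm_mulS => //; solve_eqm.
exists (f (Some true)), (f (Some false)), (f None).
by split; rewrite {1}Ef.
Qed.

Lemma w_neq1 : w - 1 != 0.
Proof. by rewrite /w -tofrac1 -tofracB tofrac_eq0 polyXsubC_eq0. Qed.

(** This is a factor of the leading coefficient of S in V; its value at [w = 1] is 5. *)
Lemma w_cyclotomic : 1 + w + w ^+ 2 + w ^+ 3 + w ^+ 4 != 0.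
Proof.
rewrite /w -tofrac1 -!tofracXn -!tofracD tofrac_eq0; apply/eqP => E.
have := congr1 (fun p : {poly rat} => p.[1]) E.
by rewrite !(hornerD, hornerXn, hornerX, hornerC, horner0, expr1n).
Qed.

Lemma addr1_eq (R : comNzRingType) (X u : R) : X = 1 + u -> u = X - 1.
Proof. by move=> ->; rewrite addrC addKr. Qed.

Lemma clear_denominators (R : comNzRingType) (a b s p X Y : R) : a * s = 1 -> b * p = 1 ->
  X = Y * s * p ^+ 3 -> a * b ^+ 3 * X = Y.
Proof.
move=> E1 E2 ->; transitivity ((a * s) * (b * p) ^+ 3 * Y); first by ring.
by rewrite E1 E2 expr1n !mul1r.
Qed.
Lemma catalytic_solution (z : A) : z 0%N = 0 -> z <> 0 -> z * (1 - z) ^+ 3 = psT ->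
  exists v : A, [/\ v 0%N = 0, S_expr v z (psC w) = 0 &
    Rden_expr v z (psC w) * (M11 : A) = Rnum_expr v z (psC w)].
Proof.
move=> z0 zn0 zT.
have [p [pz p0]] := ps_inv_exists (one_minus_z z0).
have [c Ec] : exists c : A, c = omw 1 by exists (omw 1).
have [d Ed] : exists d : A, d = omw (-2) by exists (omw (-2)).
have cw : c = psC w by rewrite Ec /omw expr1z.
have cd : c ^+ 2 * d = 1 by rewrite expr2 Ec Ed -!omwD omw0.
have c00 : c 0%N != 0 by rewrite cw; apply: w_neq0.
have d00 : d 0%N != 0.
  have := congr1 (fun f : A => f 0%N) cd; rewrite /= psM0 ps1E /= => E.
  by apply/eqP => d0; move/eqP: E; rewrite d0 mulr0 eq_sym oner_eq0.
have [u [v [s [Fu Fv Fs1]]]] := catalytic_system p c d z0.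
have u0 : u 0%N = 0 by rewrite Fu psM0 z0 mul0r.
have v0 : v 0%N = 0 by rewrite Fv psM0 z0 mul0r.
have s0 : s 0%N = 1 by rewrite Fs1 psBE psM0 z0 mul0r subr0.
have sa : (1 + z * u) * s = 1 by rewrite mulrDl mul1r {1}Fs1; ring.
have a0 : (1 + z * v) 0%N = 1 by rewrite psDE psM0 z0 mul0r addr0.
have [s' [sa' s'0]] := ps_inv_exists a0.
have Eu : (1 + z * u) * (1 - z) ^+ 3 * u =
    z * c * (1 + z * v) * (1 + u) ^+ 2 * (1 - 2 * z - z ^+ 2 * v).
  by apply: clear_denominators sa pz _; rewrite {1}Fu !mulrA.
have Ev : (1 + z * u) * (1 - z) ^+ 3 * v =
    z * d * (1 + z * v) * (1 + u) * (1 + v) * (1 - 2 * z - z ^+ 2 * u).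
  by apply: clear_denominators sa pz _; rewrite {1}Fv !mulrA.
pose x := (1 + u) * s ^+ 2; pose y := (1 + v) * s' ^+ 2.
have Ex : x * (1 + z * u) ^+ 2 = 1 + u.
  by rewrite /x -mulrA [s ^+ 2 * _]mulrC -exprMn sa expr1n mulr1.
have Ey : y * (1 + z * v) ^+ 2 = 1 + v.
  by rewrite /y -mulrA [s' ^+ 2 * _]mulrC -exprMn sa' expr1n mulr1.
have x0 : x 0%N = 1 by rewrite /x psM0 psDE psX0 u0 s0 addr0 expr1n mulr1.
have y0 : y 0%N = 1 by rewrite /y psM0 psDE psX0 v0 s'0 addr0 expr1n mulr1.
have qn0 (r : A) : r 0%N = 0 -> 1 - 2 * z - z ^+ 2 * r <> 0.
  move=> r0; apply: ps_neq0.
  by rewrite !(psM0, psBE, ps1E, z0, r0, mulr0, subr0) oner_neq0.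
have unit1 (f : A) k : f 0%N = 1 -> f ^+ k <> 0.
  by move=> f0; apply: ps_neq0; rewrite psX0 f0 expr1n oner_neq0.
have au0 : (1 + z * u) 0%N = 1 by rewrite psDE psM0 z0 mul0r addr0.
have b0 := one_minus_z z0.
have cn0 : c <> 0 by exact: ps_neq0 c00.
have dn0 : d <> 0 by exact: ps_neq0 d00.
have onep (f : A) : f 0%N = 0 -> (1 + f) 0%N = 1 by move=> f0; rewrite psDE f0 addr0.
have un0 : u <> 0.
  rewrite Fu; apply: ps_mul_neq0 => //; apply: ps_mul_neq0 (unit1 _ 3%N p0).
  apply: ps_mul_neq0 (unit1 _ 1%N s0); apply: ps_mul_neq0 (qn0 _ v0).
  apply: ps_mul_neq0 (unit1 _ 2%N (onep _ u0)); exact: ps_mul_neq0 cn0 (unit1 _ 1%N a0).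
have vn0 : v <> 0.
  rewrite Fv; apply: ps_mul_neq0 => //; apply: ps_mul_neq0 (unit1 _ 3%N p0).
  apply: ps_mul_neq0 (unit1 _ 1%N s0); apply: ps_mul_neq0 (qn0 _ u0).
  apply: ps_mul_neq0 (unit1 _ 1%N (onep _ v0)); apply: ps_mul_neq0 (unit1 _ 1%N (onep _ u0)).
  exact: ps_mul_neq0 dn0 (unit1 _ 1%N a0).
(* If [X = 1], then [r * (1 - 2 z - z^2 r) = 0], although the second factor has constant term 1 and
   [r] is nonzero. *)
have neq1 (r X : A) : r 0%N = 0 -> r <> 0 -> X * (1 + z * r) ^+ 2 = 1 + r -> X <> 1.
  move=> r0 rn0 EX X1; apply: (ps_mul_neq0 rn0 (qn0 r r0)).
  transitivity (1 + r - (1 + z * r) ^+ 2); first by ring.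
  by rewrite -EX X1 mul1r subrr.
have [Efx Ef1] := Fs_param z0 zT x0 (neq1 _ _ u0 un0 Ex) (addr1_eq Ex).
have [Efy _] := Fs_param z0 zT y0 (neq1 _ _ v0 vn0 Ey) (addr1_eq Ey).
have kx : x - 1 = psT * c * x * Fs x * (x * Fs y).
  apply: (ps_mulI (ps_mul_neq0 (unit1 _ 4%N au0) (unit1 _ 3%N b0))).
  exact: kernel_x (esym zT) Ex Efx Efy Eu.
have ky : y - 1 = psT * d * x * Fs x * (y * Fs y).
  apply: (ps_mulI (ps_mul_neq0 (ps_mul_neq0 (unit1 _ 2%N au0) (unit1 _ 2%N a0)) (unit1 _ 3%N b0))).
  exact: kernel_y (esym zT) Ex Ey Efx Efy Ev.
have EM : d * Hs omw 1 1 = y * Fs y - Fs 1.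
  rewrite Ed; apply: (@kernel_method omw x y omw0 omwD (neq1 _ _ u0 un0 Ex) (neq1 _ _ v0 vn0 Ey)).
    by rewrite -Ec.
  by rewrite -Ed.
exists v; rewrite -cw; split=> //; last first.
  by rewrite M11E; exact: (rational_form Ey Efy Ef1 cd EM).
have ratio : u * (1 - 2 * z - z ^+ 2 * u) * (1 + v) =
    c ^+ 3 * v * (1 - 2 * z - z ^+ 2 * v) * (1 + u).
  apply: (ps_mulI (ps_mul_neq0 (unit1 _ 1%N au0) (unit1 _ 3%N b0))).
  exact: ratio_eq Eu Ev cd.
have c1n0 : c - 1 <> 0 by apply: ps_neq0; rewrite psBE cw; apply: w_neq1.
have := eliminate Ev cd ratio.
(* The extraneous factors of the resultant are nonzero; for [c - 1] this holds because [w] is an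
   indeterminate. *)
have /ps_mulI K := ps_mul_neq0 (ps_mul_neq0 (ps_mul_neq0 (ps_mul_neq0 zn0 (unit1 _ 4%N b0)) vn0) c1n0)
  (ps_mul_neq0 cn0 cn0).
by rewrite -[in X in X -> _](mulr0 (z * (1 - z) ^+ 4 * v * (c - 1) * c ^+ 2)) => /K.
Qed.

Theorem theorem4p2 (z V0 : fps) :
  z 0%N = 0 -> z 1%N = 1 ->
  peval ('X * (1 - 'X) ^+ 3) z =1 fps_X ->
  V0 0%N = 0 ->
  eval2 Spoly fps_X V0 =1 (fun _ => 0) ->
  fps_algebraic M11 /\
  M11 =1 fps_div (eval2 Rnum z (fps_comp V0 z)) (eval2 Rden z (fps_comp V0 z)).
Proof.
move: z V0; change fps with A => z V0 z0 z1 zT V00 SV0.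
have {}zT : z * (1 - z) ^+ 3 = psT.
  transitivity (psev z ('X * (1 - 'X) ^+ 3)); last by rewrite -pevalE; apply: psP.
  rewrite rmorphM rmorphXn rmorphB rmorph1.
  by congr (_ * (1 - _) ^+ 3); rewrite /= psev_X.
have zn0 : z <> 0.
  by move=> E; move: z1; rewrite E => /eqP; rewrite eq_sym oner_eq0.
have [v [v0 Sv RM]] := catalytic_solution z0 zn0 zT.
(* Composition with [z] is a ring morphism fixing [w] and sending the variable to [z], so [V0(z)]
   is, like [v], a root of [S] without constant term. *)
have EV : fps_comp V0 z = v :> A.
  rewrite fps_compE //; apply: (S_expr_unique z0 _ v0 _ Sv).
    by rewrite /psub big_ord1 mulr1 /psmap V00 rmorph0.
  pose phi : {rmorphism A -> A} := psubm z0 \o psmap (psC (R := K)).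
  have phiT : phi psT = z by rewrite /phi /= psmap_psT; apply: psub_psT.
  have phiC : phi (psC w) = psC w by rewrite /phi /= psmap_psC; apply: psub_const.
  rewrite -[psub _ _]/(phi V0) -{1}phiT -phiC -rmorph_S_expr.
  suff -> : S_expr (V0 : A) psT (psC w) = 0 by rewrite rmorph0.
  by rewrite -psev2_Spoly -eval2E; apply: psP.
have Rden0 : (Rden_expr v z (psC w)) 0%N != 0.
  have -> : Rden_expr v z (psC w) = z * (v * (z ^+ 3 - 3 * z ^+ 2 + 3 * z - 1) + z ^+ 2 - 3 * z + 3) - 1.
    by move: (v) (z) => v' z'; rewrite /Rden_expr; ring.
  by rewrite psBE psM0 z0 mul0r sub0r oppr_eq0 oner_neq0.
split; last first.
  move=> n; rewrite EV; suff -> : fps_div (eval2 Rnum z v) (eval2 Rden z v) = M11 by [].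
  have -> : eval2 Rnum z v = Rnum_expr v z (psC w) :> A.
    by rewrite eval2E psev2_Rnum.
  have -> : eval2 Rden z v = Rden_expr v z (psC w) :> A.
    by rewrite eval2E psev2_Rden.
  exact: fps_divP Rden0 (esym RM).
pose c5 := Scoef5 z (psC w).
have iz := integral_z zT; have iw := integral_w.
have iv : integralOver polT (c5 * v).
  have E := Sv; rewrite S_exprE in E.
  apply: (scaled_root_integral _ _ _ _ _ _ E);
    by rewrite ?/Scoef0 ?/Scoef1 ?/Scoef2 ?/Scoef3 ?/Scoef4 ?/Scoef5; integral.
have i5 : integralOver polT c5 by rewrite /c5 /Scoef5; integral.
have c5n0 : c5 <> 0.
  have -> : c5 = z ^+ 5 * psC w * psC (1 + w + w ^+ 2 + w ^+ 3 + w ^+ 4).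
    by rewrite /c5 /Scoef5; ring.
  apply: ps_mul_neq0; first apply: ps_mul_neq0.
  - by do 4 (rewrite exprS; apply: ps_mul_neq0 => //).
  - exact: ps_neq0 w_neq0.
  - exact: ps_neq0 w_cyclotomic.
(* It is [c5 * v] that is known to be integral, and [Rnum] is quadratic in [v]; hence the multiplier
   [c5 ^+ 2]. *)
apply: (@quotient_algebraic (c5 ^+ 2 * Rden_expr v z (psC w)) (c5 ^+ 2 * Rnum_expr v z (psC w))).
- have -> : c5 ^+ 2 * Rden_expr v z (psC w) = c5 * (c5 * v * (z ^+ 4 - 3 * z ^+ 3 + 3 * z ^+ 2 - z) + c5 * (z ^+ 3 - 3 * z ^+ 2 + 3 * z - 1)).
    by move: (v) (z) (c5) => v' z' c'; rewrite /Rden_expr; ring.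
  by integral.
- have -> : c5 ^+ 2 * Rnum_expr v z (psC w) = (c5 * v * z ^+ 2 + c5 * (- z ^+ 2 + 3 * z - 1)) * (c5 * v) * psC w ^+ 2.
    by move: (v) (z) (c5) (psC w) => v' z' c' w'; rewrite /Rnum_expr; ring.
  by integral.
- by apply: ps_mul_neq0; [apply: ps_mul_neq0 | apply: ps_neq0].
- by rewrite -mulrA RM.
Qed.
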